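(* Let $X\subset Q$ be a zero-dimensional scheme with $\Delta M_X$ of size $(a,b)$. Let $P=R_h\cap C_k\in X$ for some $h\in\{0,\dots,a\}$ and $k\in\{0,\dots,b\}$ be such that $m_X(P)=1$. Given $Z=X\setminus\{P\}$, $p=\#(Z\cap R_h)$ and $q=\#(Z\cap C_k)$, suppose that one of the following conditions holds: 1. $p=b$; 2. $q=a$; 3. $p<b$, $q<a$ and $\Delta M_X^{(i,j)}=0$ for any $(i,j)\ge(q+1,p+1)$. Then $$\Delta M_Z^{(i,j)}=\begin{cases}\Delta M_X^{(i,j)} & \text{if }(i,j)\ne(q,p)\\ \Delta M_X^{(i,j)}-1 & \text{if }(i,j)=(q,p).\end{cases}$$
   Context: Let $k$ be an algebraically closed field, $Q=\mathbb P^1_k\times\mathbb P^1_k$, and $S=\bigoplus_{i,j\ge 0}H^0(Q,\mathcal O_Q(i,j))$ the bigraded coordinate ring. A $(1,0)$-line (resp. $(0,1)$-line) is the zero locus of a nonzero form of bidegree $(1,0)$ (resp. $(0,1)$). For a zero-dimensional scheme $X\subset Q$ let $I(X)\subset S$ be its saturated ideal; write $I(X)=\bigcap_{P'\in X}J_{P'}$ with $\sqrt{J_{P'}}=I_{P'}$, where $I_{P'}$ is the homogeneous ideal of the point $P'$. The Hilbert matrix of $X$ is $M_X^{(i,j)}=M_X(i,j)=\dim_k(S/I(X))_{i,j}$ ($=0$ if $i<0$ or $j<0$), and its first difference is $\Delta M_X^{(i,j)}=M_X(i,j)-M_X(i-1,j)-M_X(i,j-1)+M_X(i-1,j-1)$.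 Put $a=\min\{i: I(X)_{i,0}\neq0\}-1$, $b=\min\{j: I(X)_{0,j}\ne0\}-1$; then $\Delta M_X$ is said to be of size $(a,b)$. $R_0,\dots,R_a$ and $C_0,\dots,C_b$ denote, respectively, the $(1,0)$-lines and the $(0,1)$-lines containing $X$, each of them containing at least one point of $X$. For a line $L$ defined by a form $l$, $\#(X\cap L)$ denotes the degree of the scheme defined by the saturation of $(I(X),l)$ (the number of points of $X$ on $L$). $m_X(P)$ is the length of $\mathcal O_{X,P}$. If $m_X(P)=1$, $X\setminus\{P\}$ is the scheme with ideal $\bigcap_{P'\in X\setminus\{P\}}J_{P'}$. $(i_1,j_1)\ge(i_2,j_2)$ means $i_1\ge i_2$ and $j_1\ge j_2$. *)

(* Defs.v *)
(* ClassicalEpsilon only turns the relations "is the dimension of" and "is the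
   degree of" into functions. *)
From HB Require Import structures.
From mathcomp Require Import all_boot all_order all_algebra.
From mathcomp Require Import mpoly.
From Stdlib Require Import ClassicalEpsilon.

Set Implicit Arguments.
Unset Strict Implicit.
Unset Printing Implicit Defensive.

Import Order.TTheory GRing.Theory Num.Theory.
Local Open Scope ring_scope.

(* S = k[x_0, x_1, y_0, y_1]: the first two variables have bidegree (1,0), the
   last two have bidegree (0,1). *)
Notation bring k := {mpoly k[2 + 2]}.

Section BigradedRing.
Variable k : closedFieldType.
Implicit Types (f g l : bring k) (J : bring k -> Prop).

Definition bidegree (m : 'X_{1..2 + 2}) : nat * nat :=
  ((\sum_(t < 2) m (lshift 2 t))%N, (\sum_(t < 2) m (rshift 2 t))%N).

(* The zero polynomial is a form of every bidegree. *)
Definition bihom (i j : nat) f : Prop :=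
  forall m, m \in msupp f -> bidegree m = (i, j).

Definition bipart (i j : nat) f : bring k :=
  \sum_(m <- msupp f | bidegree m == (i, j)) f@_m *: 'X_[m].

(* The unit ideal (the ideal of the empty scheme) is allowed. *)
Definition is_ideal J : Prop :=
  [/\ J 0, (forall f g, J f -> J g -> J (f + g))
    & (forall f g, J g -> J (f * g))].

Definition bihom_ideal J : Prop :=
  is_ideal J /\ forall f i j, J f -> J (bipart i j f).

Definition radical J f : Prop := exists n : nat, J (f ^+ n).

Definition primary J : Prop :=
  ~ J 1 /\ forall f g, J (f * g) -> J f \/ radical J g.

(* J : B^oo for the irrelevant ideal B = (x_0, x_1) (y_0, y_1); the ideal B^n is
   generated by the forms of bidegree (n, n). *)
Definition saturation J f : Prop :=
  exists n : nat, forall g, bihom n n g -> J (g * f).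

Definition add_form J l f : Prop := exists g h, J g /\ f = g + h * l.

(* e is a basis of the quotient space S_{i,j} / J_{i,j}. *)
Definition quotient_basis J (i j n : nat) (e : 'I_n -> bring k) : Prop :=
  (forall t, bihom i j (e t)) /\
  forall f, bihom i j f ->
    exists! c : 'rV[k]_n, J (f - \sum_(t < n) c 0 t *: e t).

Definition hilb J (i j : nat) : nat :=
  epsilon (inhabits 0%N)
    (fun n => exists e : 'I_n -> bring k, quotient_basis J i j e).

(* Degree of the zero-dimensional scheme with saturated ideal J: the constant
   value of its Hilbert polynomial. *)
Definition scheme_degree J : nat :=
  epsilon (inhabits 0%N)
    (fun d => exists N : nat,
       forall i j : nat, (N <= i)%N -> (N <= j)%N -> hilb J i j = d).

(* Homogeneous coordinates of a point of P^1 x P^1; equality of points is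
   [same_point], not Leibniz equality. *)
Record qpoint := QPoint {
  qx : 'rV[k]_2;
  qy : 'rV[k]_2;
  qx_neq0 : qx != 0;
  qy_neq0 : qy != 0
}.

Definition same_point (P P' : qpoint) : Prop :=
  exists c d : k, [/\ c != 0, d != 0, qx P' = c *: qx P & qy P' = d *: qy P].

Definition eval_at f (P : qpoint) : k := f.@[row_mx (qx P) (qy P) 0].

(* The ideal generated by the bihomogeneous forms vanishing at P. *)
Definition point_ideal (P : qpoint) f : Prop :=
  forall i j, eval_at (bipart i j f) P = 0.

(* A zero-dimensional scheme is given by its finitely many distinct points and
   by the primary decomposition of its saturated ideal: no component is
   supported on the irrelevant locus (see [zideal_saturated]), and the component
   at a point is uniquely determined since all the points are closed. *)
Record zscheme := ZScheme {
  zsupp : finType;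
  zpt : zsupp -> qpoint;
  zcomp : zsupp -> bring k -> Prop;
  zpt_inj : forall s t, same_point (zpt s) (zpt t) -> s = t;
  zcomp_ideal : forall s, bihom_ideal (zcomp s);
  zcomp_primary : forall s, primary (zcomp s);
  zcomp_radical : forall s f, radical (zcomp s) f <-> point_ideal (zpt s) f
}.

Definition zideal (X : zscheme) f : Prop := forall s : zsupp X, zcomp s f.

Section Remove.
Variables (X : zscheme) (s : zsupp X).

Let rsupp : finType := {t : zsupp X | t != s}.

Fact remove_inj (t u : rsupp) :
  same_point (zpt (val t)) (zpt (val u)) -> t = u.
Proof. by move=> /zpt_inj /val_inj. Qed.

(* X \ {P} for P = zpt s. *)
Definition zremove : zscheme :=
  @ZScheme rsupp (fun t => zpt (val t)) (fun t => zcomp (val t)) remove_inj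
    (fun t => zcomp_ideal (val t)) (fun t => zcomp_primary (val t))
    (fun t => zcomp_radical (val t)).

End Remove.

(* O_{Q,P}, as a subring of the fraction field of S. *)
Definition local_ring (P : qpoint) (z : {fraction bring k}) : Prop :=
  exists i j f g, [/\ bihom i j f, bihom i j g, eval_at g P != 0
                    & z = FracField.tofrac f / FracField.tofrac g].

(* The kernel of O_{Q,P} -> O_{X,P}, for X with bihomogeneous ideal J. *)
Definition local_ideal J (P : qpoint) (z : {fraction bring k}) : Prop :=
  exists i j f g, [/\ bihom i j f, bihom i j g, J f, eval_at g P != 0
                    & z = FracField.tofrac f / FracField.tofrac g].

(* The O_{X,P}-submodules of O_{X,P}, seen as the O_{Q,P}-submodules lying
   between the kernel of O_{Q,P} -> O_{X,P} and O_{Q,P}. *)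
Definition local_submod J (P : qpoint) (N : {fraction bring k} -> Prop) : Prop :=
  [/\ forall z, local_ideal J P z -> N z,
      forall z, N z -> local_ring P z,
      forall z w, N z -> N w -> N (z + w)
    & forall z w, local_ring P z -> N w -> N (z * w)].

Definition local_chain J (P : qpoint) (n : nat) : Prop :=
  exists N : nat -> {fraction bring k} -> Prop,
    (forall t, (t <= n)%N -> local_submod J P (N t)) /\
    (forall t, (t < n)%N ->
       (forall z, N t z -> N t.+1 z) /\ exists2 z, N t.+1 z & ~ N t z).

(* m_X(P) = n: the length of O_{X,P} is the largest length of a strict chain of
   submodules. *)
Definition mult_is (X : zscheme) (P : qpoint) (n : nat) : Prop :=
  local_chain (zideal X) P n /\
  forall m, local_chain (zideal X) P m -> (m <= n)%N.

Definition hilbM (X : zscheme) (i j : int) : int :=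
  match i, j with
  | Posz i', Posz j' => (hilb (zideal X) i' j')%:Z
  | _, _ => 0
  end.

Definition dhilbM (X : zscheme) (i j : int) : int :=
  hilbM X i j - hilbM X (i - 1) j - hilbM X i (j - 1) + hilbM X (i - 1) (j - 1).

(* a + 1 = min {i | I(X)_{i,0} <> 0} and b + 1 = min {j | I(X)_{0,j} <> 0}. *)
Definition has_size (X : zscheme) (a b : nat) : Prop :=
  let nz i j := exists f, [/\ bihom i j f, zideal X f & f != 0] in
  [/\ nz a.+1 0%N, forall i, nz i 0%N -> (a < i)%N,
      nz 0%N b.+1 & forall j, nz 0%N j -> (b < j)%N].

Definition meets (X : zscheme) l : Prop :=
  exists s : zsupp X, eval_at l (zpt s) = 0.

(* The a+1 lines (resp. b+1 lines) whose union contains X as a scheme, i.e. the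
   product of whose equations lies in I(X). They are listed with multiplicity:
   a line may be repeated when X is not reduced. *)
Definition row_lines (X : zscheme) (a : nat) (R : 'I_a.+1 -> bring k) : Prop :=
  (forall t, [/\ bihom 1%N 0%N (R t), R t != 0 & meets X (R t)]) /\
  zideal X (\prod_t R t).

Definition col_lines (X : zscheme) (b : nat) (C : 'I_b.+1 -> bring k) : Prop :=
  (forall t, [/\ bihom 0%N 1%N (C t), C t != 0 & meets X (C t)]) /\
  zideal X (\prod_t C t).

Definition meet_at l l' (P : qpoint) : Prop :=
  forall P', eval_at l P' = 0 /\ eval_at l' P' = 0 <-> same_point P P'.

(* #(X \cap L), for the line L with equation l. *)
Definition on_line (X : zscheme) l : nat :=
  scheme_degree (saturation (add_form (zideal X) l)).

Lemma bipart_id i j f : bihom i j f -> bipart i j f = f.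
Proof.
move=> hf; rewrite [RHS]mpolyE /bipart big_seq_cond [RHS]big_seq.
by apply: eq_bigl => m; case: (boolP (m \in msupp f)) => //= /hf ->; rewrite eqxx.
Qed.

Lemma zideal_saturated X f : saturation (zideal X) f -> zideal X f.
Proof.
case=> n hn s; set P := zpt s.
have nz (v : 'rV[k]_2) : v != 0 -> exists i, v 0 i != 0.
  move=> v0; apply/existsP; apply: contraNT v0 => /existsPn h.
  by apply/eqP/rowP=> i; rewrite mxE; apply/eqP; have := h i; rewrite negbK.
have [i xi] := nz _ (qx_neq0 P); have [j yj] := nz _ (qy_neq0 P).
pose m := ((U_(lshift 2 i) + U_(rshift 2 j)) *+ n)%MM.
have bm : bidegree m = (n, n).
  rewrite /bidegree; congr pair.
    rewrite (bigD1 i) //= big1 => [|t ti]; rewrite mulmnE mnmDE !mnm1E eq_rlshift.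
      by rewrite eqxx /= mul1n addn0.
    by rewrite (inj_eq (@lshift_inj _ _)) eq_sym (negPf ti).
  rewrite (bigD1 j) //= big1 => [|t tj]; rewrite mulmnE mnmDE !mnm1E eq_lrshift.
    by rewrite eqxx /= mul1n addn0.
  by rewrite (inj_eq (@rshift_inj _ _)) eq_sym (negPf tj).
have hm : bihom n n ('X_[m] : bring k).
  by move=> u; rewrite msuppX inE => /eqP ->.
have := hn _ hm s; rewrite mulrC => /(proj2 (zcomp_primary s)) [//|].
move=> /zcomp_radical /(_ n n); rewrite bipart_id // /eval_at -mpolyXn mpolyXD.
rewrite rmorphXn rmorphM /= !mevalXU row_mxEl row_mxEr => /eqP.
by rewrite expf_eq0 mulf_eq0 (negPf xi) (negPf yj) andbF.
Qed.

End BigradedRing.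

(* Main.v *)
Require Import Defs.
From HB Require Import structures.
From mathcomp Require Import all_boot all_order all_algebra.
From mathcomp Require Import mpoly.
From mathcomp Require Import polyXY ring zify.
From Stdlib Require Import Classical ClassicalEpsilon.

Set Implicit Arguments.
Unset Strict Implicit.
Unset Printing Implicit Defensive.

Import Order.TTheory GRing.Theory Num.Theory.
Local Open Scope ring_scope.

(** Call (i, j) separating if some form of bidegree (i, j) in I(Z) does not
    vanish at P. Since m_X(P) = 1, the component of I(X) at P consists of the
    forms vanishing at P ([mult1_zcomp]), so M_X(i, j) - M_Z(i, j) is 1 if (i, j)
    is separating and 0 otherwise ([affine_hilb_origin_part]). Hence the theorem
    says that (i, j) is separating exactly when i >= q and j >= p: the second
    difference of the indicator function of this quadrant is 1 at (q, p) and 0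
    elsewhere.

    Let G be the form of degree p in one coordinate that cuts out Z on the line
    R_h; it does not vanish at P. The restriction to R_h of a separating form of
    bidegree (i, j) is a nonzero multiple of G, so j >= p, and likewise i >= q
    ([separates_geq]). As being separating is preserved when the bidegree grows,
    it remains to see that (q, p) is separating.

    If p = b, remove the equation of C_c from the product of the equations of
    the lines C_t: the remaining form of degree b is proportional to G on R_h, so
    it misses P, and its product with the form of degree q cutting out Z on C_c is
    a separating form ([separates_corner]). The case q = a is symmetric.

    In the third case, (N, p) and (q, N) are separating for N large: this is
    Nakayama's lemma along each of the two lines ([separates_line]). One goes down
    from there to (q, p) ([separates_descent]): it is enough that if
    (i + 1, j) and (i, j + 1) are separating, with (i, j) >= (q, p), then so is
    (i, j). Otherwise the difference of M_Z at (i + 1, j + 1) would be that of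
    M_X plus 1, that is 1, whereas it is at most 0 wherever I(Z) has a form not
    vanishing at P ([affine_hilb_corner]).

    All this is done in an affine chart with P as origin and with lines at
    infinity missing X, where the forms of bidegree (i, j) become the polynomials
    in k[y][x] of degree at most i in x and at most j in y. The Hilbert function
    ([hilbE]), membership in the ideal of a scheme ([affine_idealE]) and the
    number of points on a line ([on_line_row], [on_line_col]) are read in that
    chart. The symmetry between the two rulings is the exchange of x and y. *)

(** * Ideals of commutative rings *)
Definition ideal (T : comNzRingType) (I : T -> Prop) : Prop :=
  [/\ I 0, (forall f g, I f -> I g -> I (f + g))
    & (forall f g, I g -> I (f * g))].

Section IdealFacts.
Variables (T : comNzRingType) (I : T -> Prop).
Hypothesis idI : ideal I.

Lemma ideal0 : I 0. Proof. by case: idI. Qed.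
Lemma idealD f g : I f -> I g -> I (f + g). Proof. by case: idI => _ h _; apply: h. Qed.
Lemma ideal_mull f g : I g -> I (f * g). Proof. by case: idI => _ _; apply. Qed.
Lemma ideal_mulr f g : I f -> I (f * g). Proof. by rewrite mulrC; apply: ideal_mull. Qed.
Lemma idealN f : I f -> I (- f). Proof. by rewrite -mulN1r; apply: ideal_mull. Qed.
Lemma idealB f g : I f -> I g -> I (f - g).
Proof. by move=> If Ig; apply/idealD/idealN. Qed.
Lemma ideal_sum (r : Type) (s : seq r) (P : pred r) F :
  (forall t, P t -> I (F t)) -> I (\sum_(t <- s | P t) F t).
Proof. by move=> h; elim/big_ind: _ => //; [exact: ideal0 | exact: idealD]. Qed.

End IdealFacts.

(** * Separators of the origin in the affine plane *)
Section Affine.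
Variable k : fieldType.
Local Notation kyx := {poly {poly k}}.
Implicit Types (f g : kyx) (I : kyx -> Prop).

(** A nonzero element of least size works: the remainder of a division by it
    lies in K and is smaller. *)
Lemma principal_ideal (K : {poly k} -> Prop) (g : {poly k}) :
  ideal K -> K g -> g != 0 ->
  exists2 G : {poly k}, G != 0 & forall f : {poly k}, K f <-> G %| f.
Proof.
move=> idK; have [n] := ubnP (size g); elim: n g => // n IH g gn Kg g0.
have [hdiv|] := classic (forall f : {poly k}, K f -> g %| f).
  exists g => // f; split; first exact: hdiv.
  by case/dvdpP => h ->; exact: ideal_mull.
move=> ndiv; have [f nf] := not_all_ex_not _ _ ndiv.
have [Kf /negP gf] := imply_to_and _ _ nf.
have rn : (size (f %% g)%R < n)%N.
  by apply: leq_trans (_ : size g <= n)%N; rewrite ?ltn_modp.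
apply: (IH _ rn); last by apply/negP.
have -> : f %% g = f - f %/ g * g by rewrite {2}(divp_eq f g) addrC addKr.
by apply: idealB => //; apply: ideal_mull.
Qed.

(** The outer indeterminate 'X stands for x and the inner one for y: these are
    the dehomogenized forms of bidegree (i, j). *)
Definition bounded i j f : bool :=
  (size f <= i.+1)%N && (size (swapXY f) <= j.+1)%N.

Lemma boundedP i j f :
  reflect (forall s t, f`_s`_t != 0 -> (s <= i)%N /\ (t <= j)%N) (bounded i j f).
Proof.
apply: (iffP andP) => [[/leq_sizeP hi /leq_sizeP hj] s t fst | h].
  split; rewrite leqNgt; apply: contra fst => lt; first by rewrite hi ?coef0.
  by rewrite -coef_swapXY hj ?coef0.
split; apply/leq_sizeP => s hs; apply/polyP => t; rewrite coef0; apply/eqP.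
  by apply: contraTT hs => /h[]; rewrite -ltnNge.
by rewrite coef_swapXY; apply: contraTT hs => /h[_]; rewrite -ltnNge.
Qed.

Lemma bounded_coef0 i j f s t :
  bounded i j f -> ((i < s) || (j < t))%N -> f`_s`_t = 0.
Proof.
move=> /boundedP h lt; apply/eqP; apply: contraTT lt => /h[].
by rewrite negb_or -!leqNgt => -> ->.
Qed.

Lemma bounded_swapXY i j f : bounded i j (swapXY f) = bounded j i f.
Proof. by rewrite /bounded swapXYK andbC. Qed.

Lemma bounded0 i j : bounded i j 0.
Proof. by rewrite /bounded raddf0 size_poly0. Qed.

Lemma boundedD i j f g : bounded i j f -> bounded i j g -> bounded i j (f + g).
Proof.
move=> /andP[f1 f2] /andP[g1 g2]; rewrite /bounded raddfD /=.
by rewrite !(leq_trans (size_polyD _ _)) // geq_max ?f1 ?f2.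
Qed.

Lemma boundedN i j f : bounded i j (- f) = bounded i j f.
Proof. by rewrite /bounded raddfN /= !size_polyN. Qed.

Lemma bounded_sum (r : Type) (s : seq r) (P : pred r) F i j :
  (forall t, P t -> bounded i j (F t)) -> bounded i j (\sum_(t <- s | P t) F t).
Proof.
by move=> h; elim/big_ind: _ => //; [exact: bounded0 | move=> *; exact: boundedD].
Qed.

Lemma boundedM i j i' j' f g :
  bounded i j f -> bounded i' j' g -> bounded (i + i') (j + j') (f * g).
Proof.
move=> /andP[f1 f2] /andP[g1 g2]; rewrite /bounded rmorphM /=.
have le m n m' n' : (m <= n.+1)%N -> (m' <= n'.+1)%N -> ((m + m').-1 <= (n + n').+1)%N.
  by lia.
by rewrite !(leq_trans (size_polyMleq _ _)) ?le.
Qed.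

Lemma boundedW i j i' j' f :
  (i <= i')%N -> (j <= j')%N -> bounded i j f -> bounded i' j' f.
Proof. by move=> ii jj /andP[f1 f2]; apply/andP; split; lia. Qed.

Lemma bounded_exists f : exists n, bounded n n f.
Proof.
by exists (size f + size (swapXY f))%N; apply/andP; split; lia.
Qed.

Lemma boundedC (p : {poly k}) i j : (size p <= j.+1)%N -> bounded i j p%:P.
Proof.
move=> hp; rewrite /bounded swapXY_polyC size_map_polyC hp andbT.
by rewrite (leq_trans (size_polyC_leq1 _)).
Qed.

Lemma bounded_const (c : k) i j : bounded i j c%:P%:P.
Proof. by apply: boundedC; apply: leq_trans (size_polyC_leq1 _) _. Qed.

Lemma bounded1 i j : bounded i j 1.
Proof. exact: (bounded_const 1). Qed.

Lemma boundedXn i j f n : bounded i j f -> bounded (n * i) (n * j) (f ^+ n).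
Proof.
move=> fb; elim: n => [|n IH]; last by rewrite exprS !mulSn; apply: boundedM.
exact: bounded1.
Qed.

Lemma bounded_lift (p : {poly k}) i j : (size p <= i.+1)%N -> bounded i j p^:P.
Proof. by rewrite -swapXY_polyC bounded_swapXY; apply: boundedC. Qed.

(** G generates the ideal of the scheme-theoretic intersection with the line
    x = 0, on which y is the coordinate; its degree is the number of points of
    that line on the scheme. *)
Definition line_gen I (G : {poly k}) : Prop :=
  G != 0 /\ forall g : {poly k}, (exists2 f, I f & f`_0 = g) <-> G %| g.

(** With Z the scheme of I and P the origin: some form of bidegree (i, j)
    through Z misses P, that is, P imposes one more condition than Z. *)
Definition separates I i j : Prop :=
  exists f, [/\ I f, bounded i j f & f`_0`_0 != 0].

Definition swapped I : kyx -> Prop := fun f => I (swapXY f).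

Lemma swapped_ideal I : ideal I -> ideal (swapped I).
Proof.
case=> I0 ID IM; rewrite /swapped; split; first by rewrite raddf0.
  by move=> f g; rewrite raddfD; apply: ID.
by move=> f g; rewrite rmorphM; apply: IM.
Qed.

Lemma separates_swapped I i j : separates (swapped I) i j <-> separates I j i.
Proof.
by split=> -[f [If fb f0]]; exists (swapXY f);
  rewrite bounded_swapXY coef_swapXY /swapped ?swapXYK in If *.
Qed.

Lemma line_gen_exists I f :
  ideal I -> I f -> f`_0 != 0 -> exists G, line_gen I G.
Proof.
move=> idI If f0; pose K (p : {poly k}) := exists2 u : kyx, I u & u`_0 = p.
have idK : ideal K.
  split; first by exists 0; [exact: ideal0 | rewrite coef0].
    move=> _ _ [g Ig <-] [h Ih <-]; exists (g + h); first exact: idealD.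
    by rewrite coefD.
  move=> u _ [g Ig <-]; exists (u%:P * g); first exact: ideal_mull.
  by rewrite coefCM.
have Kf : K f`_0 by exists f.
by have [G G0 GP] := principal_ideal idK Kf f0; exists G.
Qed.

(** The restriction of a separator to the line x = 0 is a nonzero multiple of
    G, and its degree in y is at most j. *)
Lemma separates_geq I G i j :
  line_gen I G -> separates I i j -> (size G <= j.+1)%N.
Proof.
move=> [_ GP] [f [If fb f0]].
have f00 : f`_0 != 0 by apply: contraNneq f0 => ->; rewrite coef0.
apply: leq_trans (dvdp_leq f00 _) _; first by apply/GP; exists f.
apply/leq_sizeP => t jt; exact: (bounded_coef0 fb) (_ : _ || _)%N; rewrite jt orbT.
Qed.

Lemma line_gen_coef0 I G i j :
  line_gen I G -> separates I i j -> G`_0 != 0.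
Proof.
move=> [_ GP] [f [If _ f0]]; have /dvdpP[h fE] : G %| f`_0 by apply/GP; exists f.
by apply: contraNneq f0 => G0; rewrite fE coef0M G0 mulr0.
Qed.

Lemma poly_divX (R : nzRingType) (f : {poly R}) :
  exists h : {poly R}, f = (f`_0)%:P + 'X * h.
Proof.
exists (\poly_(i < size f) f`_i.+1); apply/polyP => -[|i].
  by rewrite coefD coefC coefXM addr0.
rewrite coefD coefC coefXM add0r coef_poly /=; case: ltnP => // hi.
by rewrite nth_default // (leq_trans hi).
Qed.

(** This is Nakayama's lemma made explicit along the line x = 0. The
    y-degree of a separator has to be exactly e = deg G. Since G is the value at
    x = 0 of some element of I, division by G rewrites y^e modulo I as
    r_0 + x r_1 + ... + x^(m-1) r_(m-1) + x^m h with all deg r_i < e.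
    With m the multiplicity of the root 0 of D, so that D = x^m D', the multiple
    x^m D' h of D is in I, hence so is F = D' (y^e - sum_i x^i r_i). At x = 0 it
    has degree e and is a multiple of G, so it is proportional to G, which does
    not vanish at the origin. *)
Lemma separates_line I G (D : {poly k}) :
  ideal I -> line_gen I G -> G`_0 != 0 -> D != 0 -> I D^:P ->
  exists N, separates I N (size G).-1.
Proof.
move=> idI [G0 GP] G00 D0 ID; set e := (size G).-1.
have eG : size G = e.+1 by rewrite prednK // lt0n size_poly_eq0.
have [m [D' D'0 DE]] := multiplicity_XsubC D 0.
rewrite D0 /= subr0 in D'0 DE.
have [g Ig gG] : exists2 g, I g & g`_0 = G by apply/GP.
have [g' gE] := poly_divX g; rewrite gG in gE.
have red n : exists r h : kyx, [/\ I (('X^e)%:P - r - 'X^n * h) &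
    forall s, (size (r`_s)%R <= e)%N].
  elim: n => [|n [r [h [Irh hr]]]].
    exists 0, (('X^e)%:P); rewrite expr0 mul1r subr0 subrr.
    by split=> [|s]; [exact: ideal0 | rewrite coef0 size_poly0].
  have [h' hE] := poly_divX h; set h0 := h`_0 in hE.
  rewrite {1}(divp_eq h0 G) in hE.
  exists (r + 'X^n * (h0 %% G)%:P)%R, (h' - (h0 %/ G)%:P * g')%R; split.
    have -> : ('X^e)%:P - (r + 'X^n * (h0 %% G)%:P)
              - 'X^(n.+1) * (h' - (h0 %/ G)%:P * g')
            = ('X^e)%:P - r - 'X^n * h + 'X^n * (h0 %/ G)%:P * g.
      rewrite hE gE polyCD polyCM exprSr; ring.
    by apply: idealD => //; apply: ideal_mull.
  move=> s; rewrite coefD (leq_trans (size_polyD _ _)) // geq_max hr /=.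
  rewrite coefXnM; case: ltnP; rewrite ?size_poly0 // coefC => _.
  by case: eqP => _; rewrite ?size_poly0 // -ltnS -eG ltn_modp.
have [r [h [Irh hr]]] := red m.
pose F := D'^:P * (('X^e)%:P - r).
have IF : I F.
  have -> : F = D'^:P * (('X^e)%:P - r - 'X^m * h) + h * D^:P.
    rewrite /F DE rmorphM /= map_polyXn; ring.
  by apply: idealD => //; apply: ideal_mull.
have F0 : F`_0 = D'`_0 *: ('X^e - r`_0).
  by rewrite coef0M coefB coef_map coefC /= mul_polyC.
have D'00 : D'`_0 != 0 by rewrite -horner_coef0.
have szF : size F`_0 = e.+1.
  by rewrite F0 size_scale // size_polyDl size_polyXn // size_polyN ltnS.
have [M rM] := bounded_exists r.
have rb : bounded M e r.
  apply/boundedP => s t st; split; first by case: (boundedP _ _ _ rM s t st).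
  apply: contraTT st; rewrite -ltnNge negbK => et.
  by apply/eqP/nth_default; apply: leq_trans (hr s) (ltnW et).
exists (size D' + M)%N, F; split=> //.
  rewrite -[X in bounded _ X]add0n; apply: boundedM.
    by apply: bounded_lift.
  by apply: boundedD; rewrite ?boundedN // boundedC ?size_polyXn.
have /dvdpP[c Fc] : G %| F`_0 by apply/GP; exists F.
have c0 : c != 0.
  by apply/eqP => c0; move: szF; rewrite Fc c0 mul0r size_poly0.
have c1 : size c = 1%N.
  by move: szF; rewrite Fc size_mul // eG addnS /= -addn1 addnC => /addnI.
rewrite Fc coef0M mulf_neq0 //.
by have := lead_coef_eq0 c; rewrite /lead_coef c1 /= (negPf c0) => ->.
Qed.

(** Write E = y E'. On the line x = 0, G divides E = y E' and is prime to y, so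
    it divides E'; the degrees force E' to be proportional to G, so that E' does
    not vanish at the origin. If f in I restricts to H on the line y = 0, then
    f = H + y h and E' H = E' f - h E lies in I; this is the separator. *)
Lemma separates_corner I G H (E : {poly k}) :
  ideal I -> line_gen I G -> line_gen (swapped I) H -> G`_0 != 0 -> H`_0 != 0 ->
  E != 0 -> I E%:P -> E`_0 = 0 -> (size E <= (size G).+1)%N ->
  separates I (size H).-1 (size G).-1.
Proof.
move=> idI [G0 GP] [H0 HP] G00 H00 E0 IE E00 sE.
have [E' EE] : exists E' : {poly k}, E = 'X * E'.
  by have [h ->] := poly_divX E; exists h; rewrite E00 polyC0 add0r.
have E'0 : E' != 0 by apply: contraNneq E0 => E'0; rewrite EE E'0 mulr0.
have sE' : size E = (size E').+1 by rewrite EE mulrC size_mulX.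
have GE' : G %| E'.
  have coX : coprimep G 'X.
    by rewrite -['X]subr0 -polyC0 coprimep_XsubC /root horner_coef0.
  by rewrite -(Gauss_dvdpr _ coX) -EE; apply/GP; exists E%:P; rewrite ?coefC.
have [c c0 E'G] : exists2 c, c != 0 & E' = c *: G.
  apply/eqpf_eq; rewrite eqp_sym -(dvdp_size_eqp GE') eqn_leq dvdp_leq //=.
  by rewrite -ltnS -sE'.
have [f If fH] : exists2 f, swapped I f & f`_0 = H by apply/HP.
have [h hE] := poly_divX f; rewrite fH in hE.
exists (H^:P * E'%:P); split.
- have -> : H^:P * E'%:P = E'%:P * swapXY f - swapXY h * E%:P.
    rewrite hE rmorphD rmorphM /= swapXY_polyC swapXY_X EE polyCM; ring.
  by apply: idealB => //; apply: ideal_mull.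
- rewrite -[X in bounded X]addn0 -[X in bounded _ X]add0n; apply: boundedM.
    by apply: bounded_lift; rewrite prednK // lt0n size_poly_eq0.
  by apply: boundedC; rewrite E'G size_scale // prednK // lt0n size_poly_eq0.
- by rewrite !coef0M coef_map !coefC /= E'G coefZ !mulf_neq0.
Qed.

End Affine.

(** * Dimension counts *)
Section Subspaces.
Variable k : fieldType.

Definition is_subspace (V : lmodType k) (J : V -> Prop) : Prop :=
  J 0 /\ forall (c : k) (v w : V), J v -> J w -> J (c *: v + w).

(** The Hilbert function is defined by predicates; the choice of a subspace with
    the same elements gives access to dimensions. *)
Definition vspace_of (V : vectType k) (J : V -> Prop) : {vspace V} :=
  epsilon (inhabits 0%VS) (fun U => forall v, v \in U <-> J v).

(** Subspaces contained in J can be enlarged by a line until they exhaust J; the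
    dimension bounds the number of steps. *)
Lemma mem_vspace_of (V : vectType k) (J : V -> Prop) v :
  is_subspace J -> v \in vspace_of J <-> J v.
Proof.
case=> J0 JD; move: v; rewrite /vspace_of; apply epsilon_spec.
have [n] := ubnP (dim V - \dim (0%VS : {vspace V})).
have : forall v, v \in (0%VS : {vspace V}) -> J v by move=> v; rewrite memv0 => /eqP->.
elim: n (0%VS : {vspace V}) => // n IH U UJ Un.
have [JU|nJU] := classic (forall v, J v -> v \in U).
  by exists U => v; split; [exact: UJ | exact: JU].
have [v nv] := not_all_ex_not _ _ nJU; have [Jv /negP vU] := imply_to_and _ _ nv.
apply: (IH (<[v]> + U)%VS) => [w /memv_addP[_ /vlineP[c ->] [u /UJ Ju ->]]|].
  exact: JD.
have : (\dim U < \dim (<[v]> + U))%N.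
  rewrite ltn_neqAle dimvS ?addvSr // andbT; apply: contra vU => /eqP dU.
  have /eqP -> : U == (<[v]> + U)%VS by rewrite eqEdim addvSr /= dU.
  by rewrite memvE addvSl.
have := dimvS (subvf (<[v]> + U)%VS); rewrite dimvf; lia.
Qed.

(** The rank formula for the map from E to W / U. *)
Lemma dim_image_add (V W : vectType k) (f : 'Hom(V, W)) (E : {vspace V})
    (U : {vspace W}) :
  (\dim (f @: E + U) + \dim (E :&: f @^-1: U) = \dim E + \dim U)%N.
Proof.
have sub : (lker f <= f @^-1: U)%VS.
  by apply/subvP => v; rewrite memv_ker -memv_preim => /eqP ->; apply: mem0v.
have -> : \dim (E :&: f @^-1: U) = (\dim (E :&: lker f) + \dim (f @: E :&: U))%N.
  rewrite -(limg_ker_dim f (E :&: f @^-1: U)) -capvA (capv_idPr sub).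
  congr (_ + \dim _)%N; apply/eqP; rewrite eqEsubv; apply/andP; split.
    apply: subv_trans (limg_cap _ _ _) _; apply: capvS => //.
    by apply/subvP => _ /memv_imgP[v + ->]; rewrite -memv_preim.
  apply/subvP => w /memv_capP[/memv_imgP[v vE ->] fvU].
  by apply: memv_img; rewrite memv_cap vE -memv_preim.
by have := limg_ker_dim f E; have := dimv_sum_cap (f @: E) U; lia.
Qed.

(** The maps (f1, f2) and g1 - g2 induce a complex
    V0/U0 -> V1/U1 + V2/U2 -> V3/U3 which is injective on the left and
    surjective on the right, whence the inequality of dimensions. The kernel of
    the second map is not formed: V3/U3 is filtered by the image of V1, and
    V0/U0 by the preimage of U2. *)
Lemma dim_square (V0 V1 V2 V3 : vectType k)
    (f1 : 'Hom(V0, V1)) (f2 : 'Hom(V0, V2)) (g1 : 'Hom(V1, V3)) (g2 : 'Hom(V2, V3))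
    (U0 : {vspace V0}) (U1 : {vspace V1}) (U2 : {vspace V2}) (U3 : {vspace V3}) :
  (forall v, g1 (f1 v) = g2 (f2 v)) ->
  (forall v, f1 v \in U1 -> f2 v \in U2 -> v \in U0) ->
  (forall v, v \in U1 -> g1 v \in U3) -> (forall v, v \in U2 -> g2 v \in U3) ->
  (limg g2 + (limg g1 + U3))%VS = fullv ->
  (dim V3 + dim V0 + \dim U1 + \dim U2 <= dim V1 + dim V2 + \dim U3 + \dim U0)%N.
Proof.
move=> comm inj gU1 gU2 surj.
have ha := dim_image_add g1 fullv U3.
have hb := dim_image_add g2 fullv (limg g1 + U3); rewrite surj in hb.
have hc := dim_image_add f2 fullv U2; set E := (_ :&: _)%VS in hc.
have hd := dim_image_add f1 E U1.
rewrite !dimvf !capfv in ha hb hc.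
have i1 : (\dim (limg f2 + U2) <= \dim (g2 @^-1: (limg g1 + U3)))%N.
  rewrite dimvS // subv_add; apply/andP; split; apply/subvP => v.
    case/memv_imgP => w _ ->; rewrite -memv_preim -comm.
    by rewrite (subvP (addvSl _ _)) // memv_img // memvf.
  by move=> /gU2 vU; rewrite -memv_preim (subvP (addvSr _ _)).
have i2 : (\dim (f1 @: E + U1) <= \dim (g1 @^-1: U3))%N.
  rewrite dimvS // subv_add; apply/andP; split; apply/subvP => v.
    case/memv_imgP => w + ->; rewrite memv_cap -!memv_preim comm.
    by case/andP => _ /gU2.
  by move=> /gU1; rewrite -memv_preim.
have i3 : (\dim (E :&: f1 @^-1: U1) <= \dim U0)%N.
  rewrite dimvS //; apply/subvP => v; rewrite !memv_cap -!memv_preim.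
  by case/andP => /andP[_ v2] v1; apply: inj.
lia.
Qed.

Lemma dim_lker_functional (V : vectType k) (ev : 'Hom(V, k^o)) (U : {vspace V}) v :
  v \in U -> ev v != 0 -> \dim U = (\dim (U :&: lker ev)).+1.
Proof.
move=> vU ev0; rewrite -(limg_ker_dim ev U).
have le1 : (\dim (ev @: U) <= 1)%N.
  by apply: leq_trans (dimvS (subvf _)) _; rewrite dimvf.
have : \dim (ev @: U) != 0%N.
  rewrite dimv_eq0; apply: contra ev0 => /eqP U0.
  by have := memv_img ev vU; rewrite U0 memv0.
by move: le1; lia.
Qed.

End Subspaces.

(** * Hilbert functions of ideals of the affine plane *)
Section AffineHilbert.
Variable k : fieldType.
Local Notation kyx := {poly {poly k}}.
Implicit Types (f g : kyx) (K : kyx -> Prop).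

Definition bipoly i j (A : 'M[k]_(i.+1, j.+1)) : kyx :=
  \poly_(s < i.+1) \poly_(t < j.+1) A (inord s) (inord t).

Definition coefmx i j f : 'M[k]_(i.+1, j.+1) := \matrix_(s, t) f`_s`_t.

Lemma bipolyK i j : cancel (@bipoly i j) (coefmx i j).
Proof.
move=> A; apply/matrixP => s t.
by rewrite mxE coef_poly ltn_ord coef_poly ltn_ord !inord_val.
Qed.

Lemma bounded_bipoly i j (A : 'M_(i.+1, j.+1)) : bounded i j (bipoly A).
Proof.
apply/boundedP => s t; rewrite coef_poly ltnS; case: leqP => [_|_]; last first.
  by rewrite coef0 eqxx.
by rewrite coef_poly ltnS; case: leqP => //; rewrite eqxx.
Qed.

Lemma coefmxK i j f : bounded i j f -> bipoly (coefmx i j f) = f.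
Proof.
move=> fb; apply/polyP => s; apply/polyP => t; rewrite coef_poly ltnS.
case: leqP => [si|si]; last by rewrite coef0 (bounded_coef0 fb) ?si.
rewrite coef_poly ltnS; case: leqP => tj; last by rewrite (bounded_coef0 fb) ?tj ?orbT.
by rewrite mxE !inordK.
Qed.

Lemma bipoly_linear i j c (A B : 'M_(i.+1, j.+1)) :
  bipoly (c *: A + B) = c%:P *: bipoly A + bipoly B.
Proof.
rewrite -[LHS](@coefmxK i j) ?bounded_bipoly // -[RHS](@coefmxK i j).
  rewrite bipolyK; congr bipoly; apply/matrixP => s t.
  have bE (C : 'M_(i.+1, j.+1)) : (bipoly C)`_s`_t = C s t.
    by rewrite -[in RHS](bipolyK C) mxE.
  by rewrite !mxE coefD coefZ coefD coefCM !bE.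
apply/boundedD/bounded_bipoly; rewrite -mul_polyC.
apply: (@boundedM _ 0 0 i j); last exact: bounded_bipoly.
exact: bounded_const.
Qed.

(** The base field acts on k[y][x] through the constants. *)
Definition is_ksubspace K :=
  K 0 /\ forall (c : k) f g, K f -> K g -> K (c%:P *: f + g).

Lemma ideal_ksubspace K : ideal K -> is_ksubspace K.
Proof.
move=> idK; split; first exact: ideal0.
by move=> c f g Kf Kg; apply: idealD => //; rewrite -mul_polyC; apply: ideal_mull.
Qed.

Definition graded_part i j K : {vspace 'M[k]_(i.+1, j.+1)} :=
  vspace_of (fun A => K (bipoly A)).

Lemma mem_graded_part i j K A :
  is_ksubspace K -> A \in graded_part i j K <-> K (bipoly A).
Proof.
move=> [K0 KD]; apply: (mem_vspace_of (J := fun A => K (bipoly A))); split.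
  have := bipoly_linear (-1) (0 : 'M_(i.+1, j.+1)) 0.
  by rewrite scaler0 addr0 polyCN scaleN1r addNr => ->.
by move=> c u v Ku Kv; rewrite bipoly_linear; apply: KD.
Qed.

Definition affine_hilb K i j : nat := (i.+1 * j.+1 - \dim (graded_part i j K))%N.

Lemma affine_hilbE K i j : (affine_hilb K i j + \dim (graded_part i j K) = i.+1 * j.+1)%N.
Proof.
rewrite /affine_hilb subnK //; apply: leq_trans (dimvS (subvf _)) _.
by rewrite dimvf dim_matrix.
Qed.

Lemma bipoly_coef i j (A : 'M[k]_(i.+1, j.+1)) (s : 'I_i.+1) (t : 'I_j.+1) :
  (bipoly A)`_s`_t = A s t.
Proof. by rewrite -[in RHS](bipolyK A) mxE. Qed.

(** The product by w is truncated to make it a map between spaces of matrices;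
    it is only used when no coefficient is lost. *)
Definition mul_coefmx i j i' j' (w : kyx) (A : 'M[k]_(i.+1, j.+1)) :
  'M[k]_(i'.+1, j'.+1) := coefmx i' j' (w * bipoly A).

Fact mul_coefmx_linear i j i' j' w : linear (@mul_coefmx i j i' j' w).
Proof.
move=> c A B; apply/matrixP => s t.
by rewrite !mxE bipoly_linear mulrDr -scalerAr coefD coefZ coefD coefCM.
Qed.

HB.instance Definition _ i j i' j' w :=
  GRing.isLinear.Build k _ _ _ (@mul_coefmx i j i' j' w) (@mul_coefmx_linear i j i' j' w).

Definition corner_entry i j (A : 'M[k]_(i.+1, j.+1)) : k^o := A ord0 ord0.

Fact corner_entry_linear i j : linear (@corner_entry i j).
Proof. by move=> c A B; rewrite /corner_entry !mxE. Qed.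

HB.instance Definition _ i j :=
  GRing.isLinear.Build k _ _ _ (@corner_entry i j) (@corner_entry_linear i j).

(** For the ideal I of a scheme missing the origin, the polynomials that vanish
    on the union of this scheme and the origin. *)
Definition origin_part (I : kyx -> Prop) f : Prop := I f /\ f`_0`_0 = 0.

Lemma origin_part_ksubspace I : ideal I -> is_ksubspace (origin_part I).
Proof.
move=> idI; have [I0 ID] := ideal_ksubspace idI.
split; first by split; rewrite ?coef0.
move=> c f g [If f0] [Ig g0]; split; first exact: ID.
by rewrite coefD coefZ coefD coefCM f0 g0 mulr0 addr0.
Qed.

(** On the degree (i, j) part of I the value at the origin is a linear form,
    which is nonzero exactly when I separates the origin in this degree. *)
Lemma affine_hilb_origin_part (I : kyx -> Prop) i j :
  ideal I ->
  (separates I i j ->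
     affine_hilb (origin_part I) i j = (affine_hilb I i j).+1) /\
  (~ separates I i j -> affine_hilb (origin_part I) i j = affine_hilb I i j).
Proof.
move=> idI; set I' := origin_part I.
have sI := ideal_ksubspace idI; have sI' := origin_part_ksubspace idI.
pose ev := linfun (@corner_entry i j).
have evE A : ev A = A ord0 ord0 by rewrite lfunE.
have grI' : graded_part i j I' = (graded_part i j I :&: lker ev)%VS.
  apply/vspaceP => A; rewrite memv_cap memv_ker evE.
  apply/idP/andP => [/(mem_graded_part _ sI')[IA A0]|].
    split; first exact/mem_graded_part.
    by move: A0; rewrite (bipoly_coef A ord0 ord0) => ->.
  case=> /(mem_graded_part _ sI) IA /eqP A0; apply/mem_graded_part => //.
  by split=> //; rewrite (bipoly_coef A ord0 ord0).
have h := affine_hilbE I i j; have h' := affine_hilbE I' i j; split.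
  case=> f [If fb f0]; rewrite grI' in h'.
  have := @dim_lker_functional _ _ ev (graded_part i j I) (coefmx i j f).
  rewrite evE mxE => d; have {d} := d _ f0.
  have -> : coefmx i j f \in graded_part i j I by apply/mem_graded_part; rewrite ?coefmxK.
  by move=> /(_ isT) d; apply: (addIn (etrans h' _)); rewrite -h d addSnnS.
move=> nsep; rewrite /affine_hilb grI' (capv_idPl _) //.
apply/subvP => A /(mem_graded_part _ sI) IA; rewrite memv_ker evE.
apply/eqP; apply: NNPP => A0; apply: nsep; exists (bipoly A); split=> //.
  exact: bounded_bipoly.
by rewrite (bipoly_coef A ord0 ord0); apply/eqP.
Qed.

(** Multiplication by x and y gives a complex
    S_(i,j) -> S_(i+1,j) + S_(i,j+1) -> S_(i+1,j+1), to be taken modulo I. With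
    F in I the separator, it is surjective on the right, since x, y and F
    generate all polynomials bounded by (i+1, j+1), and injective on the left,
    since F = c + y a + x b with c <> 0: if x h and y h lie in I then so does
    c h. *)
Lemma affine_hilb_corner (I : kyx -> Prop) i j :
  ideal I -> separates I i.+1 j.+1 ->
  (affine_hilb I i.+1 j.+1 + affine_hilb I i j <=
   affine_hilb I i.+1 j + affine_hilb I i j.+1)%N.
Proof.
move=> idI [F [IF Fb F0]].
have sI := ideal_ksubspace idI.
pose f1 := linfun (@mul_coefmx i j i.+1 j 'X).
pose f2 := linfun (@mul_coefmx i j i j.+1 'Y).
pose g1 := linfun (@mul_coefmx i.+1 j i.+1 j.+1 'Y).
pose g2 := linfun (@mul_coefmx i j.+1 i.+1 j.+1 'X).
have bX s t (A : 'M[k]_(s.+1, t.+1)) : bounded s.+1 t ('X * bipoly A).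
  apply: (@boundedM _ 1 0 s t); last exact: bounded_bipoly.
  have -> : 'X = ('X : {poly k})^:P by rewrite map_polyX.
  by apply: bounded_lift; rewrite size_polyX.
have bY s t (A : 'M[k]_(s.+1, t.+1)) : bounded s t.+1 ('Y * bipoly A).
  apply: (@boundedM _ 0 1 s t); last exact: bounded_bipoly.
  by apply: boundedC; rewrite size_polyX.
have f1E A : bipoly (f1 A) = 'X * bipoly A by rewrite lfunE /= coefmxK.
have f2E A : bipoly (f2 A) = 'Y * bipoly A by rewrite lfunE /= coefmxK.
have g1E A : bipoly (g1 A) = 'Y * bipoly A by rewrite lfunE /= coefmxK.
have g2E A : bipoly (g2 A) = 'X * bipoly A by rewrite lfunE /= coefmxK.
have taylor s t f : bounded s.+1 t.+1 f ->
    exists a b, [/\ bounded s.+1 t a, bounded s t.+1 b &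
      f = (f`_0`_0)%:P%:P + 'Y * a + 'X * b].
  move=> fb; have [b fE] := poly_divX f; have [a f0E] := poly_divX f`_0.
  exists a%:P, b; split.
  - apply: boundedC; apply/leq_sizeP => n sn.
    have <- : f`_0`_n.+1 = a`_n by rewrite [in LHS]f0E coefD coefC coefXM add0r.
    by apply: bounded_coef0 fb _; rewrite ltnS sn orbT.
  - apply/boundedP => u v.
    have -> : b`_u`_v = f`_u.+1`_v by rewrite [in RHS]fE coefD coefC coefXM add0r.
    by move=> /(boundedP _ _ _ fb).
  - by rewrite [LHS]fE [in LHS]f0E polyCD polyCM.
have h00 := affine_hilbE I i j; have h10 := affine_hilbE I i.+1 j.
have h01 := affine_hilbE I i j.+1; have h11 := affine_hilbE I i.+1 j.+1.
have [FA [FB [FAb FBb FE]]] := taylor _ _ _ Fb; set F00 := F`_0`_0 in FE F0.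
suff : (dim 'M[k]_(i.+2, j.+2) + dim 'M[k]_(i.+1, j.+1) +
   \dim (graded_part i.+1 j I) + \dim (graded_part i j.+1 I) <=
   dim 'M[k]_(i.+2, j.+1) + dim 'M[k]_(i.+1, j.+2) +
   \dim (graded_part i.+1 j.+1 I) + \dim (graded_part i j I))%N.
  by rewrite !dim_matrix; lia.
apply: (dim_square (f1 := f1) (f2 := f2) (g1 := g1) (g2 := g2)).
- by move=> A; apply: (can_inj (@bipolyK i.+1 j.+1)); rewrite g1E g2E f1E f2E mulrCA.
- move=> A /(mem_graded_part _ sI); rewrite f1E => I1.
  move=> /(mem_graded_part _ sI); rewrite f2E => I2.
  apply/(mem_graded_part _ sI).
  suff IFA : I (F00%:P%:P * bipoly A).
    have -> : bipoly A = (F00^-1)%:P%:P * (F00%:P%:P * bipoly A).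
      by rewrite mulrA -!polyCM mulVf // mul1r.
    exact: ideal_mull.
  have -> : F00%:P%:P * bipoly A =
      bipoly A * F - FA * ('Y * bipoly A) - FB * ('X * bipoly A).
    by rewrite FE; ring.
  by do !(apply: idealB => //); apply: ideal_mull.
- move=> A /(mem_graded_part _ sI) IA; apply/(mem_graded_part _ sI).
  by rewrite g1E; apply: ideal_mull.
- move=> A /(mem_graded_part _ sI) IA; apply/(mem_graded_part _ sI).
  by rewrite g2E; apply: ideal_mull.
apply/eqP; rewrite eqEsubv subvf /=; apply/subvP => A _.
have [a [b [ab bb AE]]] := taylor _ _ _ (bounded_bipoly A).
set c := (bipoly A)`_0`_0 / F00.
have cE : (bipoly A)`_0`_0 = c * F00 by rewrite /c divfK.
have scalb u v (w : kyx) : bounded u v w -> bounded u v (c%:P%:P * w).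
  move=> wb; apply: (@boundedM _ 0 0 u v) => //.
  exact: bounded_const.
have -> : A = g2 (coefmx i j.+1 (b - c%:P%:P * FB)) +
     (g1 (coefmx i.+1 j (a - c%:P%:P * FA)) + coefmx i.+1 j.+1 (c%:P%:P * F)).
  apply: (can_inj (@bipolyK i.+1 j.+1)).
  have bD u v : {morph @bipoly u v : M N / M + N >-> M + N}.
    by move=> M N; rewrite -[M]scale1r bipoly_linear scale1r polyC1 scale1r.
  rewrite !bD g1E g2E !coefmxK ?scalb //; last 2 first.
  - by apply: boundedD; rewrite ?boundedN ?scalb.
  - by apply: boundedD; rewrite ?boundedN ?scalb.
  by rewrite FE AE cE !polyCM; ring.
apply: memv_add; first by apply: memv_img; apply: memvf.
apply: memv_add; first by apply: memv_img; apply: memvf.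
apply/mem_graded_part => //; rewrite coefmxK ?scalb //; exact: ideal_mull.
Qed.

End AffineHilbert.

(** * Bihomogeneous forms *)
Section Forms.
Variable k : closedFieldType.
Implicit Types (f g : bring k).

Lemma bidegreeD (m n : 'X_{1..2 + 2}) :
  bidegree (m + n)%MM = ((bidegree m).1 + (bidegree n).1, (bidegree m).2 + (bidegree n).2)%N.
Proof. by rewrite /bidegree -!big_split; congr pair; apply: eq_bigr => t _; rewrite mnmDE. Qed.

Lemma bihom0 i j : bihom i j (0 : bring k).
Proof. by move=> m; rewrite msupp0. Qed.

Lemma bihomD i j f g : bihom i j f -> bihom i j g -> bihom i j (f + g).
Proof. by move=> hf hg m /msuppD_le; rewrite mem_cat => /orP[/hf|/hg]. Qed.

Lemma bihomZ i j c f : bihom i j f -> bihom i j (c *: f).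
Proof. by move=> hf m /msuppZ_le /hf. Qed.

Lemma bihomN i j f : bihom i j f -> bihom i j (- f).
Proof. by rewrite -scaleN1r; apply: bihomZ. Qed.

Lemma bihom_sum (r : Type) (s : seq r) (P : pred r) F i j :
  (forall t, P t -> bihom i j (F t)) -> bihom i j (\sum_(t <- s | P t) F t : bring k).
Proof.
by move=> h; elim/big_ind: _ => //; [exact: bihom0 | move=> *; exact: bihomD].
Qed.

Lemma bihomM i j i' j' f g :
  bihom i j f -> bihom i' j' g -> bihom (i + i') (j + j') (f * g).
Proof.
move=> hf hg m /msuppM_le /allpairsP[[m1 m2] /= [/hf d1 /hg d2 ->]].
by rewrite bidegreeD d1 d2.
Qed.

Lemma bihom_mulX (m : 'X_{1..2 + 2}) :
  bihom (bidegree m).1 (bidegree m).2 ('X_[m] : bring k).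
Proof. by move=> n; rewrite msuppX inE => /eqP ->; case: bidegree. Qed.

Lemma bihom1 : bihom 0 0 (1 : bring k).
Proof.
move=> m; rewrite msupp1 inE => /eqP ->.
by rewrite /bidegree !big1 // => t _; rewrite mnm0E.
Qed.

Lemma bihomXn i j f n : bihom i j f -> bihom (n * i) (n * j) (f ^+ n).
Proof.
move=> hf; elim: n => [|n IH]; first exact: bihom1.
by rewrite exprS !mulSn; apply: bihomM.
Qed.

Lemma bihom_prod (r : eqType) (s : seq r) (P : pred r) F (d e : r -> nat) :
  (forall t, P t -> bihom (d t) (e t) (F t)) ->
  bihom (\sum_(t <- s | P t) d t) (\sum_(t <- s | P t) e t)
    (\prod_(t <- s | P t) F t : bring k).
Proof.
move=> h; elim/big_ind3: _ => //; first exact: bihom1.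
by move=> *; apply: bihomM.
Qed.

Lemma bihom_bipart i j f : bihom i j (bipart i j f).
Proof.
rewrite /bipart; apply: bihom_sum => m /eqP dm; apply: bihomZ.
by have := @bihom_mulX m; rewrite dm.
Qed.

Lemma sum_bipart f :
  exists N, f = \sum_(i < N) \sum_(j < N) bipart i j f.
Proof.
pose N := (\max_(m <- msupp f) maxn (bidegree m).1 (bidegree m).2).+1; exists N.
transitivity (\sum_(m <- msupp f) \sum_(i < N) \sum_(j < N)
    if bidegree m == (val i, val j) then f@_m *: 'X_[m] else 0); last first.
  rewrite [LHS]exchange_big. apply: eq_bigr => i _; rewrite [LHS]exchange_big.
  by apply: eq_bigr => j _; rewrite -big_mkcond.
rewrite [in LHS](mpolyE f) big_seq [RHS]big_seq; apply: eq_bigr => m mf.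
have := @leq_bigmax_seq _ (msupp f) xpredT
  (fun m : 'X_{1..2 + 2} => maxn (bidegree m).1 (bidegree m).2) m mf isT.
rewrite geq_max -ltnS -[X in _ && X]ltnS -/N; case: (bidegree m) => [d e] /andP[lt1 lt2].
rewrite (bigD1 (Ordinal lt1)) //= (bigD1 (Ordinal lt2)) //= eqxx.
rewrite !big1 ?addr0 // => [i|j] ne.
  rewrite big1 // => j _; case: eqP => // -[di _]; case/eqP: ne.
  exact/val_inj/esym.
by case: eqP => // -[dj]; case/eqP: ne; apply/val_inj/esym.
Qed.

Lemma eval_atM (P : qpoint k) f g : eval_at (f * g) P = eval_at f P * eval_at g P.
Proof. by rewrite /eval_at mevalM. Qed.

Lemma eval_atD (P : qpoint k) f g : eval_at (f + g) P = eval_at f P + eval_at g P.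
Proof. by rewrite /eval_at mevalD. Qed.

Lemma eval_atXn (P : qpoint k) n f : eval_at (f ^+ n) P = eval_at f P ^+ n.
Proof. by rewrite /eval_at rmorphXn. Qed.

Lemma eval_at_prod (P : qpoint k) (r : Type) (s : seq r) (Q : pred r) F :
  eval_at (\prod_(t <- s | Q t) F t) P = \prod_(t <- s | Q t) eval_at (F t) P.
Proof. by rewrite /eval_at rmorph_prod. Qed.

Definition lform (v : 'I_2 -> 'I_(2 + 2)) (w : 'I_2 -> k) : bring k :=
  \sum_(t < 2) w t *: 'X_(v t).

Lemma bihom_xform w : bihom 1 0 (lform (@lshift 2 2) w).
Proof.
apply: bihom_sum => t _; apply: bihomZ.
suff dt : bidegree U_(lshift 2 t)%MM = (1, 0)%N.
  by have := @bihom_mulX U_(lshift 2 t)%MM; rewrite dt.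
rewrite /bidegree; congr pair; last first.
  by rewrite big1 // => i _; rewrite mnm1E eq_lrshift.
rewrite (bigD1 t) //= big1 => [|i it]; rewrite mnm1E ?eqxx //.
by rewrite (inj_eq (@lshift_inj _ _)) eq_sym (negPf it).
Qed.

Lemma bihom_yform w : bihom 0 1 (lform (@rshift 2 2) w).
Proof.
apply: bihom_sum => t _; apply: bihomZ.
suff dt : bidegree U_(rshift 2 t)%MM = (0, 1)%N.
  by have := @bihom_mulX U_(rshift 2 t)%MM; rewrite dt.
rewrite /bidegree; congr pair.
  by rewrite big1 // => i _; rewrite mnm1E eq_rlshift.
rewrite (bigD1 t) //= big1 => [|i it]; rewrite mnm1E ?eqxx //.
by rewrite (inj_eq (@rshift_inj _ _)) eq_sym (negPf it).
Qed.

Lemma eval_xform w P : eval_at (lform (@lshift 2 2) w) P = \sum_t w t * qx P 0 t.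
Proof.
rewrite /eval_at raddf_sum; apply: eq_bigr => t _ /=.
by rewrite mevalZ mevalXU row_mxEl.
Qed.

Lemma eval_yform w P : eval_at (lform (@rshift 2 2) w) P = \sum_t w t * qy P 0 t.
Proof.
rewrite /eval_at raddf_sum; apply: eq_bigr => t _ /=.
by rewrite mevalZ mevalXU row_mxEr.
Qed.

Lemma mpoly_rmorph_eq (T : nzRingType) (phi psi : {rmorphism bring k -> T}) :
  (forall c, phi c%:MP = psi c%:MP) -> (forall t, phi 'X_t = psi 'X_t) ->
  phi =1 psi.
Proof.
move=> hC hX f; rewrite [f]mpolyE !rmorph_sum; apply: eq_bigr => m _.
rewrite -mul_mpolyC !rmorphM hC mpolyXE_id !rmorph_prod; congr (_ * _).
by apply: eq_bigr => t _; rewrite !rmorphXn hX.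
Qed.

End Forms.

Arguments bihomXn {k i j f} n _.
Arguments bihom_xform {k} w.
Arguments bihom_yform {k} w.
Arguments bihom_mulX {k} m.

(** * An affine chart of the quadric *)
Section Chart.
Variable k : closedFieldType.
Local Notation kyx := {poly {poly k}}.
Variables A0 A1 B0 B1 : 'I_2 -> k.

(** The chart sends (x, y) to the point (A0 + x A1, B0 + y B1): its origin is
    (A0, B0), and A1, B1 are the points at infinity of the two factors. *)
Definition dehom_var (i : 'I_(2 + 2)) : kyx :=
  match split i with
  | inl t => (A0 t)%:P%:P + 'X * (A1 t)%:P%:P
  | inr t => (B0 t)%:P%:P + 'Y * (B1 t)%:P%:P
  end.

Definition dehomogenize : bring k -> kyx := mmap (polyC \o polyC) dehom_var.
HB.instance Definition _ := GRing.RMorphism.on dehomogenize.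
Local Notation dehom := dehomogenize.

Lemma dehomB f g : dehom (f - g) = dehom f - dehom g. Proof. exact: rmorphB. Qed.

Lemma dehom_sum (r : Type) (s : seq r) (P : pred r) (F : r -> bring k) :
  dehom (\sum_(t <- s | P t) F t) = \sum_(t <- s | P t) dehom (F t).
Proof. exact: rmorph_sum. Qed.

Lemma dehomM f g : dehom (f * g) = dehom f * dehom g.
Proof. exact: rmorphM. Qed.

Lemma dehomX f n : dehom (f ^+ n) = dehom f ^+ n.
Proof. exact: rmorphXn. Qed.

Lemma dehomC c : dehom c%:MP = c%:P%:P.
Proof. exact: mmapC. Qed.

Lemma dehomZ c f : dehom (c *: f) = c%:P%:P * dehom f.
Proof. exact: mmapZ. Qed.

Lemma dehomXl t : dehom 'X_(lshift 2 t) = (A0 t)%:P%:P + 'X * (A1 t)%:P%:P.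
Proof. by rewrite /dehomogenize mmapX mmap1U /dehom_var (unsplitK (inl t)). Qed.

Lemma dehomXr t : dehom 'X_(rshift 2 t) = (B0 t)%:P%:P + 'Y * (B1 t)%:P%:P.
Proof. by rewrite /dehomogenize mmapX mmap1U /dehom_var (unsplitK (inr t)). Qed.

Lemma bounded_dehom i j f : bihom i j f -> bounded i j (dehom f).
Proof.
move=> hf; rewrite [f]mpolyE rmorph_sum big_seq; apply: bounded_sum => m /hf dm.
rewrite /= dehomZ; apply: (@boundedM _ 0 0 i j).
  exact: bounded_const.
rewrite mpolyXE_id rmorph_prod big_split_ord /=.
case: dm => <- <-.
have bl t : bounded 1 0 (dehom 'X_(lshift 2 t)).
  rewrite dehomXl; apply: boundedD.
    exact: bounded_const.
  apply: (@boundedM _ 1 0 0 0); last exact: bounded_const.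
  have -> : 'X = ('X : {poly k})^:P by rewrite map_polyX.
  by apply: bounded_lift; rewrite size_polyX.
have br t : bounded 0 1 (dehom 'X_(rshift 2 t)).
  rewrite dehomXr; apply: boundedD.
    exact: bounded_const.
  apply: (@boundedM _ 0 1 0 0); last exact: bounded_const.
  by apply: boundedC; rewrite size_polyX.
rewrite -[X in bounded X]addn0 -[X in bounded _ X]add0n; apply: boundedM.
  elim/big_ind2: _ => [|d g d' g' hd hd'|t _].
  - exact: bounded1.
  - exact: (boundedM hd hd').
  by have := boundedXn (m (lshift 2 t)) (bl t); rewrite rmorphXn muln1 muln0.
elim/big_ind2: _ => [|d g d' g' hd hd'|t _].
- exact: bounded1.
- exact: (boundedM hd hd').
by have := boundedXn (m (rshift 2 t)) (br t); rewrite rmorphXn muln1 muln0.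
Qed.

End Chart.

Section Rehomogenize.
Variable k : closedFieldType.
Local Notation kyx := {poly {poly k}}.
Variables A0 A1 B0 B1 : 'I_2 -> k.
Local Notation dehom := (dehomogenize A0 A1 B0 B1).

Definition det2 (u v : 'I_2 -> k) : k := u ord0 * v ord_max - u ord_max * v ord0.

Lemma sum2 (V : nmodType) (F : 'I_2 -> V) : \sum_t F t = F ord0 + F ord_max.
Proof. by rewrite big_ord_recl big_ord1; congr (_ + F _); apply: val_inj. Qed.

Lemma sum2_prod (F : 'I_2 -> kyx) : \prod_t F t = F ord0 * F ord_max.
Proof. by rewrite big_ord_recl big_ord1; congr (_ * F _); apply: val_inj. Qed.

Hypotheses (hA : det2 A0 A1 != 0) (hB : det2 B0 B1 != 0).

(** Cramer's rule: a vector w of k^2 is l(w) u + m(w) v, where l and m have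
    the coefficients denom_coef u v and coord_coef u v. In the chart l becomes 1
    and m the coordinate. *)
Definition denom_coef (u v : 'I_2 -> k) (t : 'I_2) : k :=
  (if t == ord0 then v ord_max else - v ord0) / det2 u v.
Definition coord_coef (u v : 'I_2 -> k) (t : 'I_2) : k :=
  (if t == ord0 then - u ord_max else u ord0) / det2 u v.

Definition xdenom := lform (@lshift 2 2) (denom_coef A0 A1).
Definition xcoord := lform (@lshift 2 2) (coord_coef A0 A1).
Definition ydenom := lform (@rshift 2 2) (denom_coef B0 B1).
Definition ycoord := lform (@rshift 2 2) (coord_coef B0 B1).

Lemma dehom_xlform w :
  dehom (lform (@lshift 2 2) w) = (\sum_t w t * A0 t)%:P%:P + 'X * (\sum_t w t * A1 t)%:P%:P.
Proof. by rewrite rmorph_sum !sum2 /= !dehomZ !dehomXl !polyCD !polyCM; ring. Qed.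

Lemma dehom_ylform w :
  dehom (lform (@rshift 2 2) w) = (\sum_t w t * B0 t)%:P%:P + 'Y * (\sum_t w t * B1 t)%:P%:P.
Proof. by rewrite rmorph_sum !sum2 /= !dehomZ !dehomXr !polyCD !polyCM; ring. Qed.

Lemma denom_coef0 u v : det2 u v != 0 -> \sum_t denom_coef u v t * u t = 1.
Proof. by move=> duv; rewrite sum2 /denom_coef /=; rewrite /det2 in duv *; field. Qed.
Lemma denom_coef1 u v : \sum_t denom_coef u v t * v t = 0.
Proof. by rewrite sum2 /denom_coef /=; ring. Qed.
Lemma coord_coef0 u v : \sum_t coord_coef u v t * u t = 0.
Proof. by rewrite sum2 /coord_coef /=; ring. Qed.
Lemma coord_coef1 u v : det2 u v != 0 -> \sum_t coord_coef u v t * v t = 1.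
Proof. by move=> duv; rewrite sum2 /coord_coef /=; rewrite /det2 in duv *; field. Qed.

Lemma dehom_xdenom : dehom xdenom = 1.
Proof. by rewrite dehom_xlform denom_coef0 // denom_coef1 !polyC0 mulr0 addr0. Qed.
Lemma dehom_ydenom : dehom ydenom = 1.
Proof. by rewrite dehom_ylform denom_coef0 // denom_coef1 !polyC0 mulr0 addr0. Qed.
Lemma dehom_xcoord : dehom xcoord = 'X.
Proof. by rewrite dehom_xlform coord_coef0 coord_coef1 // !polyC0 add0r polyC1 mulr1. Qed.
Lemma dehom_ycoord : dehom ycoord = 'Y.
Proof. by rewrite dehom_ylform coord_coef0 coord_coef1 // !polyC0 add0r polyC1 mulr1. Qed.

Definition rehomogenize i j (g : kyx) : bring k :=
  \sum_(s < i.+1) \sum_(t < j.+1) g`_s`_t *: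
     ((xcoord ^+ s * xdenom ^+ (i - s)) * (ycoord ^+ t * ydenom ^+ (j - t))).

Lemma bihom_rehom i j g : bihom i j (rehomogenize i j g).
Proof.
apply: bihom_sum => s _; apply: bihom_sum => t _; apply: bihomZ.
rewrite -[X in bihom X]addn0 -[X in bihom _ X]add0n; apply: bihomM.
  rewrite -{1}(subnKC (ltn_ord s : (s <= i)%N)).
  have := bihomM (bihomXn s (bihom_xform (coord_coef A0 A1)))
      (bihomXn (i - s) (bihom_xform (denom_coef A0 A1))).
  by rewrite !muln1 !muln0.
rewrite -{1}(subnKC (ltn_ord t : (t <= j)%N)).
have := bihomM (bihomXn t (bihom_yform (coord_coef B0 B1)))
      (bihomXn (j - t) (bihom_yform (denom_coef B0 B1))).
by rewrite !muln1 !muln0.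
Qed.

Lemma rehomK i j g : bounded i j g -> dehom (rehomogenize i j g) = g.
Proof.
move=> gb; have gE : g = \sum_(s < i.+1) \sum_(t < j.+1) (g`_s`_t)%:P%:P * ('X^s * 'Y^+t).
  have szle n (R : nzRingType) (p : {poly R}) : (size p <= n)%N ->
      p = \sum_(t < n) (p`_t)%:P * 'X^t.
    move=> sp; apply/polyP => t; under eq_bigr do rewrite mul_polyC.
    rewrite -(poly_def n (fun t => p`_t)) coef_poly.
    by case: ltnP => // nt; rewrite nth_default // (leq_trans sp).
  rewrite {1}(szle i.+1 _ g); last by case/andP: gb.
  apply: eq_bigr => s _; rewrite [in LHS](szle j.+1 _ g`_s); last first.
    by apply/leq_sizeP => t jt; apply: bounded_coef0 gb _; rewrite jt orbT.
  rewrite rmorph_sum mulr_suml; apply: eq_bigr => t _.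
  by rewrite /= polyCM rmorphXn /= -mulrA ['Y^+t * _]mulrC.
rewrite [RHS]gE /rehomogenize rmorph_sum; apply: eq_bigr => s _; rewrite rmorph_sum.
apply: eq_bigr => t _; rewrite /= dehomZ !rmorphM !rmorphXn /=.
by rewrite dehom_xdenom dehom_ydenom dehom_xcoord dehom_ycoord !expr1n !mulr1.
Qed.

(** This reduces the injectivity of dehomogenization on the forms of a given
    bidegree to the standard chart. There, as one variable of each factor is
    erased, it is seen on monomials. *)
Definition to_std_var (i : 'I_(2 + 2)) : bring k :=
  match split i with
  | inl t => A0 t *: 'X_(lshift 2 ord0) + A1 t *: 'X_(lshift 2 ord_max)
  | inr t => B0 t *: 'X_(rshift 2 ord0) + B1 t *: 'X_(rshift 2 ord_max)
  end.
Definition to_std : bring k -> bring k := mmap (@mpolyC _ _) to_std_var.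
HB.instance Definition _ := GRing.RMorphism.on to_std.

Definition from_std_var (i : 'I_(2 + 2)) : bring k :=
  match split i with
  | inl t => if t == ord0 then xdenom else xcoord
  | inr t => if t == ord0 then ydenom else ycoord
  end.
Definition from_std : bring k -> bring k := mmap (@mpolyC _ _) from_std_var.
HB.instance Definition _ := GRing.RMorphism.on from_std.

Lemma to_stdC c : to_std c%:MP = c%:MP. Proof. exact: mmapC. Qed.
Lemma from_stdC c : from_std c%:MP = c%:MP. Proof. exact: mmapC. Qed.
Lemma to_stdX t : to_std 'X_t = to_std_var t. Proof. by rewrite /to_std mmapX mmap1U. Qed.
Lemma from_stdX t : from_std 'X_t = from_std_var t.
Proof. by rewrite /from_std mmapX mmap1U. Qed.
Lemma from_stdZ c f : from_std (c *: f) = c *: from_std f.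
Proof. by rewrite -!mul_mpolyC rmorphM /= from_stdC. Qed.

Lemma to_stdK : cancel to_std from_std.
Proof.
have eq := @mpoly_rmorph_eq _ _ (from_std \o to_std : {rmorphism _ -> _})
  (idfun : {rmorphism bring k -> bring k}).
apply: eq => [c|i]; first by rewrite /= to_stdC from_stdC.
rewrite /= to_stdX /to_std_var.
have e (v : 'I_2 -> 'I_(2 + 2)) (u w : 'I_2 -> k) t : det2 u w != 0 ->
    u t *: lform v (denom_coef u w) + w t *: lform v (coord_coef u w) = 'X_(v t).
  rewrite /lform !sum2 /denom_coef /coord_coef /= !scalerDr !scalerA => uw.
  rewrite addrACA -!scalerDl.
  have [->|->] : t = ord0 \/ t = ord_max.
    by case: t => -[|[|//]] ?; [left | right]; apply: val_inj.
    rewrite [X in X *: _ + _](_ : _ = 1) ?[X in _ + X *: _](_ : _ = 0);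
      rewrite ?scale1r ?scale0r ?addr0 //; rewrite /det2 in uw *; by field.
  rewrite [X in X *: _ + _](_ : _ = 0) ?[X in _ + X *: _](_ : _ = 1);
    rewrite ?scale1r ?scale0r ?add0r //; rewrite /det2 in uw *; by field.
rewrite -[i]splitK; case: (split i) => t;
  rewrite unsplitK raddfD /= !from_stdZ !from_stdX /from_std_var.
  by rewrite !(unsplitK (inl _)); apply: e.
by rewrite !(unsplitK (inr _)); apply: e.
Qed.

Lemma bihom_to_std i j f : bihom i j f -> bihom i j (to_std f).
Proof.
move=> hf; rewrite [f]mpolyE rmorph_sum big_seq; apply: bihom_sum => m /hf [<- <-].
rewrite -mul_mpolyC rmorphM /= to_stdC mul_mpolyC; apply: bihomZ.
rewrite mpolyXE_id rmorph_prod big_split_ord /=.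
rewrite -[X in bihom X]addn0 -[X in bihom _ X]add0n; apply: bihomM.
  elim/big_ind2: _ => [|d g d' g' hd hd'|t _]; first exact: bihom1.
    exact: (bihomM hd hd').
  have bl : bihom 1 0 (to_std 'X_(lshift 2 t)).
    rewrite to_stdX /to_std_var (unsplitK (inl _)).
    have := bihom_xform (fun s => if s == ord0 then A0 t else A1 t).
    by rewrite /lform sum2.
  by have := bihomXn (m (lshift 2 t)) bl; rewrite -rmorphXn muln1 muln0.
elim/big_ind2: _ => [|d g d' g' hd hd'|t _]; first exact: bihom1.
  exact: (bihomM hd hd').
have br : bihom 0 1 (to_std 'X_(rshift 2 t)).
  rewrite to_stdX /to_std_var (unsplitK (inr _)).
  have := bihom_yform (fun s => if s == ord0 then B0 t else B1 t).
  by rewrite /lform sum2.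
by have := bihomXn (m (rshift 2 t)) br; rewrite -rmorphXn muln1 muln0.
Qed.

Definition unit2 (i t : 'I_2) : k := (t == i)%:R.
Local Notation dehom0 :=
  (dehomogenize (unit2 ord0) (unit2 ord_max) (unit2 ord0) (unit2 ord_max)).

Lemma dehom_to_std f : dehom f = dehom0 (to_std f).
Proof.
apply: (@mpoly_rmorph_eq _ _ (dehom : {rmorphism bring k -> kyx})
  (dehom0 \o to_std : {rmorphism _ -> _})) => [c|i].
  by rewrite /= to_stdC !dehomC.
rewrite /= to_stdX -[i]splitK; case: (split i) => t;
  rewrite /to_std_var unsplitK raddfD /= !dehomZ.
  by rewrite !dehomXl /unit2 /= !(polyC0, polyC1); ring.
by rewrite !dehomXr /unit2 /= !(polyC0, polyC1); ring.
Qed.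

Lemma dehom0_mono (m : 'X_{1..2 + 2}) :
  dehom0 'X_[m] = 'X^(m (lshift 2 ord_max)) * ('X^(m (rshift 2 ord_max)))%:P.
Proof.
rewrite mpolyXE_id rmorph_prod big_split_ord /= !sum2_prod !rmorphXn /=.
rewrite !dehomXl !dehomXr /unit2 /= !(polyC0, polyC1).
by rewrite !(mulr0, mulr1, addr0, add0r, expr1n, mul1r).
Qed.

Lemma monomial_coords (m n : 'X_{1..2 + 2}) : bidegree m = bidegree n ->
  m (lshift 2 ord_max) = n (lshift 2 ord_max) ->
  m (rshift 2 ord_max) = n (rshift 2 ord_max) -> m = n.
Proof.
rewrite /bidegree !sum2 => -[e1 e2] e3 e4.
apply/mnmP => i; rewrite -[i]splitK; case: (split i) => -[[|[|//]] ti] /=.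
- by rewrite (_ : Ordinal ti = ord0) ?(addIn e3) //; [lia | apply: val_inj].
- by rewrite (_ : Ordinal ti = ord_max) //; apply: val_inj.
- by rewrite (_ : Ordinal ti = ord0) //; [lia | apply: val_inj].
- by rewrite (_ : Ordinal ti = ord_max) //; apply: val_inj.
Qed.

Lemma dehom0_inj i j f : bihom i j f -> dehom0 f = 0 -> f = 0.
Proof.
move=> hf f0; apply/mpolyP => m0; rewrite mcoeff0.
have [m0f|] := boolP (m0 \in msupp f); last exact: memN_msupp_eq0.
have := congr1 (fun g : kyx => g`_(m0 (lshift 2 ord_max))`_(m0 (rshift 2 ord_max))) f0.
rewrite !coef0 [f in dehom0 f]mpolyE rmorph_sum !coef_sum => <-.
rewrite (bigD1_seq m0) ?msupp_uniq //= big_seq_cond big1 => [|m /andP[mf ne]].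
  rewrite dehomZ dehom0_mono coefCM coefMC coefXn eqxx mul1r.
  by rewrite coefCM coefXn eqxx mulr1 addr0.
rewrite dehomZ dehom0_mono coefCM coefMC coefXn.
case: eqP => e1; rewrite ?mul0r ?mulr0 ?coef0 // mul1r coefCM coefXn.
case: eqP => e2; rewrite ?mulr0 //; case/eqP: ne; apply/esym.
by apply: monomial_coords => //; rewrite (hf _ mf) (hf _ m0f).
Qed.

Lemma dehom_inj i j f g : bihom i j f -> bihom i j g -> dehom f = dehom g -> f = g.
Proof.
move=> hf hg fg; have hfg : bihom i j (f - g) by apply/bihomD/bihomN.
have fg0 : dehom (f - g) = 0 by rewrite dehomB fg subrr.
rewrite dehom_to_std in fg0; have std0 := dehom0_inj (bihom_to_std hfg) fg0.
by apply/eqP; rewrite -subr_eq0 -[_ - _]to_stdK std0 rmorph0.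
Qed.

End Rehomogenize.

(** * Hilbert functions read in the chart *)
Section QuotientBases.
Variables (k : fieldType) (V : vectType k) (U : {vspace V}).

(** The form that the bases of a quotient of graded parts take in the definition
    of the Hilbert function. *)
Definition basis_mod n (w : 'I_n -> V) : Prop :=
  forall v, exists! c : 'rV[k]_n, v - \sum_t c 0 t *: w t \in U.

Lemma basis_mod_card n (w : 'I_n -> V) : basis_mod w -> (n + \dim U = dim V)%N.
Proof.
move=> wU; pose W := [tuple w t | t < n].
have WE t : W`_(val t) = w t by rewrite -(tnth_nth 0 W) tnth_mktuple.
have sumE (c : 'I_n -> k) : \sum_t c t *: W`_(val t) = \sum_t (\row_s c s) 0 t *: w t.
  by apply: eq_bigr => t _; rewrite WE mxE.
have uniq0 (c : 'I_n -> k) : \sum_t c t *: W`_(val t) \in U -> forall t, c t = 0.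
  rewrite sumE => cU t; have [d [_ dU]] := wU 0.
  have : d = \row_s c s by apply: dU; rewrite sub0r rpredN.
  have -> : d = 0.
    by apply: dU; rewrite big1 ?subr0 ?mem0v // => s _; rewrite mxE scale0r.
  by move/rowP/(_ t); rewrite !mxE.
have freeW : free W.
  by apply/freeP => c c0; apply: uniq0; rewrite c0 mem0v.
have capW : (<<W>> :&: U = 0)%VS.
  apply/eqP; rewrite -subv0; apply/subvP => v /memv_capP[vW vU].
  rewrite (coord_span vW) in vU *; rewrite big1 ?mem0v // => t _.
  by rewrite (uniq0 _ vU t) scale0r.
rewrite -dimvf; have <- : (<<W>> + U)%VS = fullv.
  apply/eqP; rewrite eqEsubv subvf /=; apply/subvP => v _.
  have [c [cU _]] := wU v; rewrite -[v](subrK (\sum_t c 0 t *: w t)) addrC.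
  apply: memv_add => //; apply: memv_suml => t _; apply: memvZ.
  by apply: memv_span; rewrite -(tnth_mktuple w t) mem_tnth.
rewrite dimv_disjoint_sum // (eqP freeW) size_tuple //.
Qed.

Lemma basis_mod_exists : exists w : 'I_(dim V - \dim U) -> V, basis_mod w.
Proof.
have dC : \dim U^C = (dim V - \dim U)%N by rewrite dimv_compl dimvf.
rewrite -dC; pose B := vbasis U^C; exists (fun t => B`_t) => v.
have [u uU [w wC vE]] : exists2 u, u \in U & exists2 w, w \in U^C%VS & v = u + w.
  by apply/memv_addP; rewrite addv_complf memvf.
have BC (c : 'rV_(\dim U^C)) : \sum_t c 0 t *: B`_t \in U^C%VS.
  apply: memv_suml => t _; apply/memvZ/vbasis_mem/mem_nth.
  by rewrite size_tuple.
have wE : w = \sum_t coord B t w *: B`_t.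
  by apply: coord_span; rewrite (span_basis (vbasisP _)).
exists (\row_t coord B t w); split.
  suff -> : \sum_t (\row_s coord B s w) 0 t *: B`_t = w by rewrite vE addrK.
  by rewrite [RHS]wE; apply: eq_bigr => t _; rewrite mxE.
move=> c cU; apply/rowP => t; rewrite mxE.
have : w - \sum_t c 0 t *: B`_t \in (U :&: U^C)%VS.
  rewrite memv_cap (memvB wC) // andbT.
  have -> : w - \sum_t c 0 t *: B`_t = v - \sum_t c 0 t *: B`_t - u.
    by rewrite vE [u + w]addrC addrAC addrK.
  exact: memvB.
rewrite capv_compl memv0 subr_eq0 => /eqP ->.
by rewrite coord_sum_free // (basis_free (vbasisP _)).
Qed.

End QuotientBases.

Lemma ex_unique_iff (T : Type) (P Q : T -> Prop) :
  (forall x, P x <-> Q x) -> (exists! x, P x) <-> exists! x, Q x.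
Proof. by move=> PQ; split=> -[x [/PQ Px ux]]; exists x; split=> // y /PQ /ux. Qed.

Section HilbertFunction.
Variable k : closedFieldType.
Local Notation kyx := {poly {poly k}}.
Variables A0 A1 B0 B1 : 'I_2 -> k.
Hypotheses (hA : det2 A0 A1 != 0) (hB : det2 B0 B1 != 0).
Local Notation dehom := (dehomogenize A0 A1 B0 B1).
Local Notation rehom := (rehomogenize A0 A1 B0 B1).
Variables (J : bring k -> Prop) (K : kyx -> Prop) (i j : nat).
Hypotheses (sK : is_ksubspace K)
  (JK : forall f, bihom i j f -> J f <-> K (dehom f)).

Let form_mx f := coefmx i j (dehom f).

Let form_mx_comb n (e : 'I_n -> bring k) (c : 'rV[k]_n) f :
  form_mx (f - \sum_t c 0 t *: e t) = form_mx f - \sum_t c 0 t *: form_mx (e t).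
Proof.
apply/matrixP => s t; rewrite !mxE summxE /form_mx dehomB !coefB; congr (_ - _).
rewrite dehom_sum !coef_sum; apply: eq_bigr => u _.
by rewrite dehomZ coefCM coefCM !mxE.
Qed.

Let JE f : bihom i j f -> J f <-> form_mx f \in graded_part i j K.
Proof.
move=> hf; split=> [/(JK hf) Kf|].
  by apply/(mem_graded_part _ sK); rewrite coefmxK // bounded_dehom.
by move/(mem_graded_part _ sK); rewrite coefmxK ?bounded_dehom // => /(JK hf).
Qed.

Let comb_iff n (e : 'I_n -> bring k) f : (forall t, bihom i j (e t)) -> bihom i j f ->
  (exists! c : 'rV[k]_n, J (f - \sum_t c 0 t *: e t)) <->
  exists! c : 'rV[k]_n,
     form_mx f - \sum_t c 0 t *: form_mx (e t) \in graded_part i j K.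
Proof.
move=> he hf; apply: ex_unique_iff => c; rewrite -form_mx_comb; apply: JE.
by apply/bihomD/bihomN/bihom_sum => // t _; apply: bihomZ.
Qed.

Let form_mx_rehom A : form_mx (rehom i j (bipoly A)) = A.
Proof. by rewrite /form_mx rehomK ?bounded_bipoly // bipolyK. Qed.

Lemma quotient_basis_card n (e : 'I_n -> bring k) :
  quotient_basis J i j e -> n = affine_hilb K i j.
Proof.
move=> [he eb]; have : (n + \dim (graded_part i j K) = dim 'M[k]_(i.+1, j.+1))%N.
  apply: (@basis_mod_card _ _ _ _ (fun t => form_mx (e t))) => A.
  rewrite -(form_mx_rehom A); apply/comb_iff => //; first exact: bihom_rehom.
  exact/eb/bihom_rehom.
by rewrite dim_matrix -[RHS](affine_hilbE K i j) => /addIn.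
Qed.

Lemma hilb_basis n (e : 'I_n -> bring k) : quotient_basis J i j e -> hilb J i j = n.
Proof.
move=> eb; have ex : exists n, exists e : 'I_n -> bring k, quotient_basis J i j e.
  by exists n, e.
have [e' eb'] := epsilon_spec (inhabits 0%N) _ ex.
by rewrite /hilb (quotient_basis_card eb') (quotient_basis_card eb).
Qed.

Lemma hilbE : hilb J i j = affine_hilb K i j.
Proof.
have [w wU] := basis_mod_exists (graded_part i j K).
have : quotient_basis J i j (fun t => rehom i j (bipoly (w t))).
  split=> [t|f hf]; first exact: bihom_rehom.
  apply/comb_iff => // [t|]; first exact: bihom_rehom.
  have combE (c : 'rV[k]_ _) : \sum_t c 0 t *: form_mx (rehom i j (bipoly (w t)))
      = \sum_t c 0 t *: w t by apply: eq_bigr => t _; rewrite form_mx_rehom.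
  have [c [cU uc]] := wU (form_mx f); exists c; split=> [|d]; rewrite combE //.
  exact: uc.
by move=> eb; rewrite (hilb_basis eb) (quotient_basis_card eb).
Qed.

End HilbertFunction.

(** * The ideal of a scheme and its sections by lines *)
Section Reduction.
Variable k : fieldType.
Local Notation kyx := {poly {poly k}}.
Implicit Types (f g : kyx) (I : kyx -> Prop).

Lemma reduce_inner I (E : {poly k}) f :
  ideal I -> E != 0 -> I E%:P ->
  exists r, [/\ I (f - r), (size r <= size f)%N & (size (swapXY r) <= size E)%N].
Proof.
move=> idI E0 IE; pose r := \poly_(s < size f) (f`_s %% E).
pose q := \poly_(s < size f) (f`_s %/ E).
exists r; split; last 2 first.
- exact: size_poly.
- apply/leq_sizeP => t tE; apply/polyP => s; rewrite coef_swapXY coef0 coef_poly.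
  case: ltnP => _; rewrite ?coef0 // nth_default //.
  by apply: leq_trans tE; apply: ltnW; rewrite ltn_modp.
have -> : f - r = q * E%:P.
  apply/polyP => s; rewrite coefMC coefB !coef_poly; case: ltnP => h.
    by rewrite {1}(divp_eq f`_s E) addrK.
  by rewrite nth_default // subrr mul0r.
exact: ideal_mull.
Qed.

(** D and E make the quotient by I finite-dimensional. *)
Lemma reduce_bounded I (D E : {poly k}) f :
  ideal I -> D != 0 -> I D^:P -> E != 0 -> I E%:P ->
  exists2 r, I (f - r) & bounded (size D) (size E) r.
Proof.
move=> idI D0 ID E0 IE; have [r1 [Ir1 _ r1E]] := reduce_inner f idI E0 IE.
have ID' : swapped I D%:P by rewrite /swapped swapXY_polyC.
have [r2 [Ir2 r2E r2D]] := reduce_inner (swapXY r1) (swapped_ideal idI) D0 ID'.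
exists (swapXY r2).
  have -> : f - swapXY r2 = f - r1 + swapXY (swapXY r1 - r2).
    by rewrite raddfB /= swapXYK addrA subrK.
  exact: idealD.
rewrite bounded_swapXY /bounded (leq_trans r2E) ?(leq_trans r2D) //.
exact: leq_trans r1E _.
Qed.

End Reduction.

Section AffineIdeal.
Variable k : closedFieldType.
Local Notation kyx := {poly {poly k}}.
Variables A0 A1 B0 B1 : 'I_2 -> k.
Hypotheses (hA : det2 A0 A1 != 0) (hB : det2 B0 B1 != 0).
Local Notation dehom := (dehomogenize A0 A1 B0 B1).
Local Notation rehom := (rehomogenize A0 A1 B0 B1).
Local Notation xdenom := (xdenom A0 A1).
Local Notation ydenom := (ydenom B0 B1).
Variable Z : zscheme k.
Hypotheses (hx : forall t : zsupp Z, eval_at xdenom (zpt t) != 0)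
  (hy : forall t : zsupp Z, eval_at ydenom (zpt t) != 0).

Definition affine_ideal (J : bring k -> Prop) (g : kyx) : Prop :=
  exists2 f, J f & dehom f = g.

Lemma zcomp_is_ideal (t : zsupp Z) : ideal (zcomp t).
Proof. by case: (zcomp_ideal t) => -[]. Qed.

Lemma zideal_is_ideal : ideal (zideal Z).
Proof.
split=> [t|f g If Ig t|f g Ig t]; first exact: (ideal0 (zcomp_is_ideal t)).
  exact: (idealD (zcomp_is_ideal t)).
exact: (ideal_mull (zcomp_is_ideal t)).
Qed.

Lemma zideal_bipart f i j : zideal Z f -> zideal Z (bipart i j f).
Proof. by move=> Zf t; apply: (proj2 (zcomp_ideal t)). Qed.

Lemma zcomp_cancel (X : zscheme k) (t : zsupp X) i j f g :
  bihom i j g -> eval_at g (zpt t) != 0 -> zcomp t (f * g) -> zcomp t f.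
Proof.
move=> hg gt /(proj2 (zcomp_primary t)) [//|/zcomp_radical /(_ i j)].
by rewrite bipart_id // => /eqP; rewrite (negPf gt).
Qed.

Definition denom m n : bring k := xdenom ^+ m * ydenom ^+ n.

Lemma bihom_denom m n : bihom m n (denom m n).
Proof.
have := bihomM (bihomXn m (bihom_xform (denom_coef A0 A1)))
  (bihomXn n (bihom_yform (denom_coef B0 B1))).
by rewrite !muln1 !muln0 addn0.
Qed.

Lemma dehom_denom m n : dehom (denom m n) = 1.
Proof. by rewrite dehomM !dehomX dehom_xdenom // dehom_ydenom // !expr1n mulr1. Qed.

Lemma dehom_denomM m n f : dehom (denom m n * f) = dehom f.
Proof. by rewrite [LHS]dehomM dehom_denom mul1r. Qed.

(** The lines at infinity of the chart miss Z, so their equations are nonzero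
    divisors modulo each primary component. *)
Lemma zideal_cancel_denom m n f : zideal Z (denom m n * f) -> zideal Z f.
Proof.
move=> Zf t; apply: (zcomp_cancel (@bihom_denom m n) (t := t)).
  by rewrite eval_atM !eval_atXn mulf_neq0 // expf_neq0.
by rewrite mulrC; apply: Zf.
Qed.

(** If f and some g in the ideal have the same dehomogenization, they become
    equal after multiplication of f, and of each bihomogeneous part of g, by
    powers of the equations of the lines at infinity, and these cancel. *)
Lemma affine_idealE i j f :
  bihom i j f -> affine_ideal (zideal Z) (dehom f) <-> zideal Z f.
Proof.
move=> hf; split=> [[g Zg gf]|Zf]; last by exists f.
have [N gE] := sum_bipart g.
pose F := \sum_(s < N) \sum_(t < N) denom (N - s) (N - t) * bipart s t g.
have hF : bihom N N F.
  apply: bihom_sum => s _; apply: bihom_sum => t _.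
  have := bihomM (@bihom_denom (N - s) (N - t)) (@bihom_bipart _ s t g).
  by rewrite !subnK // ltnW.
have ZF : zideal Z F.
  do 2!(apply: (ideal_sum zideal_is_ideal) => ? _).
  by apply: (ideal_mull zideal_is_ideal); apply: zideal_bipart.
have dF : dehom F = dehom f.
  rewrite -gf [in RHS]gE !dehom_sum; apply: eq_bigr => s _; rewrite !dehom_sum.
  by apply: eq_bigr => t _; rewrite dehom_denomM.
apply: (@zideal_cancel_denom N N).
have -> : denom N N * f = denom i j * F.
  apply: (@dehom_inj _ A0 A1 B0 B1 hA hB (N + i) (N + j)).
  - exact: bihomM (@bihom_denom N N) hf.
  - by rewrite addnC [(N + j)%N]addnC; exact: bihomM (@bihom_denom i j) hF.
  - by rewrite !dehom_denomM dF.
exact: (ideal_mull zideal_is_ideal).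
Qed.

Lemma affine_ideal_is_ideal : ideal (affine_ideal (zideal Z)).
Proof.
split; first by exists 0; [exact: (ideal0 zideal_is_ideal) | exact: rmorph0].
  move=> _ _ [f Zf <-] [g Zg <-]; exists (f + g); last exact: rmorphD.
  exact: (idealD zideal_is_ideal).
move=> u _ [g Zg <-]; have [n un] := bounded_exists u.
exists (rehom n n u * g); last by rewrite dehomM rehomK.
exact: (ideal_mull zideal_is_ideal).
Qed.

Local Notation I := (affine_ideal (zideal Z)).

Variables (D E : {poly k}).
Hypotheses (D0 : D != 0) (ID : I D^:P) (E0 : E != 0) (IE : I E%:P).

(** In large bidegrees every form is, modulo the ideal of Z, a multiple of any
    given power of the equations of the lines at infinity: Z is finite and those
    lines miss it. *)
Lemma reduce_form m N g : (m + size D + size E <= N)%N -> bihom N N g ->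
  exists g', zideal Z (g - denom m m * g').
Proof.
move=> mN hg; have [r Ir rb] := reduce_bounded (dehom g) affine_ideal_is_ideal D0 ID E0 IE.
have le a b : (m + a + b <= N)%N -> [/\ (a <= N - m)%N, (b <= N - m)%N & (m <= N)%N].
  by split; lia.
have [Dm Em mleN] := le _ _ mN.
have rb' : bounded (N - m) (N - m) r by apply: boundedW rb.
exists (rehom (N - m) (N - m) r).
apply/(@affine_idealE N N).
  apply/bihomD/bihomN => //.
  rewrite -(subnKC mleN) addKn.
  exact: bihomM (@bihom_denom m m) (@bihom_rehom _ _ _ _ _ _ _ _).
by rewrite dehomB dehom_denomM rehomK.
Qed.

(** The saturation is defined with all the forms of bidegree (n, n), while the
    chart only inverts the lines at infinity; by [reduce_form] this amounts to
    the same. *)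
Lemma saturationE li lj l i j f : bihom li lj l -> bihom i j f ->
  saturation (add_form (zideal Z) l) f <-> exists h, I (dehom f - h * dehom l).
Proof.
move=> hl hf; split=> [[n]|[h Ih]].
  move=> /(_ _ (@bihom_denom n n)) [g [h [Zg e]]]; exists (dehom h), g => //.
  have := congr1 dehom e; rewrite dehom_denomM => ->.
  by rewrite -dehomM -dehomB addrK.
have [n hn] := bounded_exists h; pose M := (n + li + lj)%N.
have Zd : zideal Z (denom (n + li) (n + lj) * f - denom i j * rehom n n h * l).
  apply/(@affine_idealE (i + n + li) (j + n + lj)).
    apply/bihomD/bihomN; last exact/bihomM/hl/bihomM/bihom_rehom/bihom_denom.
    by rewrite -!addnA addnC [(j + _)%N]addnC; apply/bihomM/hf/bihom_denom.
  by rewrite dehomB [in X in _ - X]dehomM !dehom_denomM rehomK.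
exists (M + size D + size E)%N => g hg.
have [g' Zg'] := reduce_form (leqnn _) hg.
have dM : denom M M = denom lj li * denom (n + li) (n + lj).
  by rewrite /denom mulrACA -!exprD /M; congr (_ ^+ _ * _ ^+ _); lia.
exists ((g - denom M M * g') * f + (g' * denom lj li) *
   (denom (n + li) (n + lj) * f - denom i j * rehom n n h * l)),
  (g' * denom lj li * denom i j * rehom n n h); split; last by rewrite dM; ring.
apply: (idealD zideal_is_ideal); first exact: (ideal_mulr zideal_is_ideal).
exact: (ideal_mull zideal_is_ideal).
Qed.

(** A subscheme of a line is cut out by one form G in one coordinate; the powers
    of this coordinate below deg G are a basis of the quotient, by Euclidean
    division, as soon as the bidegree is large enough. *)
Lemma scheme_degree_line (J : bring k -> Prop) (rho : {additive kyx -> {poly k}})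
    (mono : nat -> kyx) (G : {poly k}) :
  G != 0 -> (forall c f, rho (c%:P%:P * f) = c *: rho f) ->
  (forall t, rho (mono t) = 'X^t) -> (forall t, bounded t t (mono t)) ->
  (forall i j f, bihom i j f -> J f <-> G %| rho (dehom f)) ->
  scheme_degree J = (size G).-1.
Proof.
move=> G0 rhoZ rho_mono mono_b JG; set e := (size G).-1.
have eG : size G = e.+1 by rewrite prednK // lt0n size_poly_eq0.
have he i j : (e <= i)%N -> (e <= j)%N -> hilb J i j = e.
  move=> ei ej; have sK : is_ksubspace (fun g => G %| rho g).
    split; first by rewrite raddf0 dvdp0.
    move=> c f g Gf Gg; rewrite raddfD dvdp_add //.
    by rewrite -mul_polyC rhoZ -mul_polyC dvdp_mull.
  apply: (hilb_basis hA hB sK (JG i j) (e := fun t : 'I_e => rehom i j (mono t))).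
  split=> [t|f hf]; first exact: bihom_rehom.
  have J_comb (c : 'rV[k]_e) :
      J (f - \sum_t c 0 t *: rehom i j (mono t)) <->
      rho (dehom f) %% G = \sum_(t < e) c 0 t *: 'X^t.
    rewrite (JG i j); last first.
      apply/bihomD/bihomN/bihom_sum => // t _; exact/bihomZ/bihom_rehom.
    have -> : rho (dehom (f - \sum_t c 0 t *: rehom i j (mono t))) =
        rho (dehom f) - \sum_(t < e) c 0 t *: 'X^t.
      rewrite dehomB raddfB /=; congr (_ - _).
      rewrite dehom_sum raddf_sum; apply: eq_bigr => t _.
      rewrite /= dehomZ rhoZ rehomK ?rho_mono //.
      exact: boundedW (leq_trans (ltnW (ltn_ord t)) ei)
        (leq_trans (ltnW (ltn_ord t)) ej) (mono_b t).
    have szc : (size (\sum_(t < e) c 0 t *: 'X^t)%R < size G)%N.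
      rewrite eG ltnS; apply: leq_trans (size_sum _ _ _) _.
      apply/bigmax_leqP => t _; apply: leq_trans (size_scale_leq _ _) _.
      by rewrite size_polyXn.
    rewrite -[G %| _]/(_ %% G == 0) modpD modpN (modp_small szc) subr_eq0.
    by split=> /eqP.
  exists (\row_t (rho (dehom f) %% G)`_t); split.
    apply/J_comb; have sz : (size (rho (dehom f) %% G)%R <= e)%N.
      by rewrite -ltnS -eG ltn_modp.
    apply/polyP => t.
    under eq_bigr do rewrite mxE.
    rewrite -(poly_def e (fun t => (rho (dehom f) %% G)`_t)) coef_poly.
    by case: ltnP => // et; rewrite nth_default // (leq_trans sz).
  move=> c /J_comb ->; apply/rowP => t; rewrite mxE.
  rewrite coef_sum (bigD1 t) //= big1 => [|s st]; rewrite coefZ coefXn.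
    by rewrite eqxx mulr1 addr0.
  by rewrite eq_sym (negPf (st : (_ != _ :> nat))) mulr0.
have ex : exists d N, forall i j, (N <= i)%N -> (N <= j)%N -> hilb J i j = d.
  by exists e, e.
have [N hN] := epsilon_spec (inhabits 0%N) _ ex.
by rewrite /scheme_degree -(hN (maxn N e) (maxn N e)) ?leq_maxl // he ?leq_maxr.
Qed.

Lemma line_gen_mod (K : kyx -> Prop) (G : {poly k}) (c : k) f :
  ideal K -> line_gen K G -> c != 0 ->
  (exists h, K (f - h * (c%:P%:P * 'X))) <-> G %| f`_0.
Proof.
move=> idK [_ GP] c0; split=> [[h Kh]|/GP[u Ku uf]].
  apply/GP; exists (f - h * (c%:P%:P * 'X)) => //.
  by rewrite mulrA coefB coefMX subr0.
have [h hE] := poly_divX (f - u); exists ((c^-1)%:P%:P * h).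
rewrite mulrACA -!polyCM mulVf // mul1r.
suff -> : f - h * 'X = u by [].
rewrite coefB uf subrr polyC0 add0r mulrC in hE.
by rewrite -hE subKr.
Qed.

Lemma on_line_row l (c : k) (G : {poly k}) : bihom 1 0 l -> dehom l = c%:P%:P * 'X ->
  c != 0 -> line_gen I G -> on_line Z l = (size G).-1.
Proof.
move=> hl lE c0 gG; apply: (@scheme_degree_line _ (coefp 0) (fun t => ('X^t)%:P)).
- by case: gG.
- by move=> a f; rewrite /= /coefp coefCM mul_polyC.
- by move=> t; rewrite /= /coefp coefC.
- by move=> t; apply: boundedC; rewrite size_polyXn.
move=> i j f hf; rewrite (saturationE hl hf) lE.
exact: line_gen_mod affine_ideal_is_ideal gG c0.
Qed.

Lemma on_line_col l (c : k) (G : {poly k}) : bihom 0 1 l -> dehom l = c%:P%:P * 'Y ->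
  c != 0 -> line_gen (swapped I) G -> on_line Z l = (size G).-1.
Proof.
move=> hl lE c0 gG.
apply: (@scheme_degree_line _ (coefp 0 \o swapXY : {additive _ -> _}) (fun t => ('X^t)^:P)).
- by case: gG.
- move=> a f; rewrite /= /coefp rmorphM /= swapXY_polyC map_polyC coefCM mul_polyC.
  by [].
- by move=> t; rewrite /= /coefp -swapXY_polyC swapXYK coefC.
- by move=> t; apply: bounded_lift; rewrite size_polyXn.
move=> i j f hf; rewrite (saturationE hl hf) lE.
rewrite -(line_gen_mod _ (swapped_ideal affine_ideal_is_ideal) gG c0).
have swE h : swapXY (h * (c%:P%:P * 'X)) = swapXY h * (c%:P%:P * 'Y).
  by rewrite !rmorphM /= swapXY_X swapXY_polyC map_polyC.
rewrite /swapped; split=> -[h Ih]; exists (swapXY h).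
  by rewrite raddfB /= swE !swapXYK.
by move: Ih; rewrite raddfB /= swE !swapXYK.
Qed.

End AffineIdeal.

(** * Points of multiplicity one *)
Section LocalRing.
Variable k : closedFieldType.
Variable P : qpoint k.
Implicit Types (f g : bring k) (Q : bring k -> Prop).
Local Notation frac := FracField.tofrac.

(** Q selects the numerators. With Q the ideal J, the forms vanishing at P, or
    all forms, these are the kernel of O_{Q,P} -> O_{X,P}, the maximal ideal of
    the local ring, and the whole local ring. *)
Definition fractions_over Q (z : {fraction bring k}) : Prop :=
  exists i j f g, [/\ bihom i j f, bihom i j g, Q f, eval_at g P != 0
                    & z = frac f / frac g].

Definition forms_ideal Q : Prop :=
  (forall f g, Q f -> Q g -> Q (f + g)) /\ (forall f g, Q g -> Q (f * g)).

Lemma eval_at_neq0 g : eval_at g P != 0 -> frac g != 0.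
Proof.
by apply: contra; rewrite tofrac_eq0 => /eqP ->; rewrite /eval_at raddf0.
Qed.

Lemma fractions_overD Q z w : forms_ideal Q ->
  fractions_over Q z -> fractions_over Q w -> fractions_over Q (z + w).
Proof.
move=> [QD QM] [i [j [f [g [hf hg Qf g0 ->]]]]] [i' [j' [f' [g' [hf' hg' Qf' g'0 ->]]]]].
exists (i + i')%N, (j + j')%N, (f * g' + f' * g), (g * g'); split.
- apply: bihomD; first exact: bihomM.
  by rewrite addnC [(j + _)%N]addnC; apply: bihomM.
- exact: bihomM.
- by apply: QD; rewrite mulrC; apply: QM.
- by rewrite eval_atM mulf_neq0.
- by rewrite addf_div ?eval_at_neq0 // rmorphD !rmorphM.
Qed.

Lemma fractions_overM Q z w : forms_ideal Q ->
  local_ring P z -> fractions_over Q w -> fractions_over Q (z * w).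
Proof.
move=> [QD QM] [i [j [f [g [hf hg g0 ->]]]]] [i' [j' [f' [g' [hf' hg' Qf' g'0 ->]]]]].
exists (i + i')%N, (j + j')%N, (f * f'), (g * g'); split; try exact: bihomM.
- exact: QM.
- by rewrite eval_atM mulf_neq0.
- by rewrite mulf_div !rmorphM.
Qed.

Lemma fractions_submod J Q : forms_ideal Q -> (forall f, J f -> Q f) ->
  local_submod J P (fractions_over Q).
Proof.
move=> hQ JQ; split.
- by move=> z [i [j [f [g [hf hg /JQ Qf g0 ->]]]]]; exists i, j, f, g.
- by move=> z [i [j [f [g [hf hg _ g0 ->]]]]]; exists i, j, f, g.
- by move=> z w; apply: fractions_overD.
- by move=> z w; apply: fractions_overM.
Qed.

Lemma fractions_overS (Q Q' : bring k -> Prop) z :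
  (forall f, Q f -> Q' f) -> fractions_over Q z -> fractions_over Q' z.
Proof. by move=> QQ' [i [j [f [g [hf hg /QQ' Qf g0 ->]]]]]; exists i, j, f, g. Qed.

Lemma form_nonzero_at i j : exists2 g, bihom i j g & eval_at g P != 0.
Proof.
have nz (v : 'rV[k]_2) : v != 0 -> exists w : 'I_2 -> k, \sum_t w t * v 0 t != 0.
  move=> v0; have /existsP[t vt] : [exists t, v 0 t != 0].
    apply: contraNT v0 => /existsPn h; apply/eqP/rowP => t; rewrite mxE.
    by have := h t; rewrite negbK => /eqP.
  exists (fun s => (s == t)%:R); rewrite (bigD1 t) //= eqxx mul1r big1 ?addr0 // => s st.
  by rewrite (negPf st) mul0r.
have [u hu] := nz _ (qx_neq0 P); have [w hw] := nz _ (qy_neq0 P).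
exists (lform (@lshift 2 2) u ^+ i * lform (@rshift 2 2) w ^+ j).
  have := bihomM (bihomXn i (bihom_xform u)) (bihomXn j (bihom_yform w)).
  by rewrite !muln1 !muln0 addn0.
by rewrite eval_atM !eval_atXn eval_xform eval_yform mulf_neq0 // expf_neq0.
Qed.

End LocalRing.

Lemma div_cross (F : fieldType) (a b c d : F) :
  b != 0 -> d != 0 -> a / b = c / d -> a * d = c * b.
Proof. by move=> b0 d0 /eqP; rewrite eqr_div // => /eqP. Qed.

Section MultiplicityOne.
Variables (k : closedFieldType) (X : zscheme k) (s : zsupp X).
Local Notation P := (zpt s).

Lemma zcomp_eval0 i j f : bihom i j f -> zcomp s f -> eval_at f P = 0.
Proof.
move=> hf sf; have /zcomp_radical /(_ i j) : radical (zcomp s) f by exists 1%N.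
by rewrite bipart_id.
Qed.

(** Otherwise the kernel of O_{Q,P} -> O_{X,P}, the maximal ideal and the whole
    local ring are three distinct submodules, so that the length is at least 2:
    a form f vanishing at P but outside the component gives an element of the
    maximal ideal that is not in the kernel, the component being primary. *)
Lemma mult1_zcomp i j f :
  mult_is X P 1 -> bihom i j f -> eval_at f P = 0 -> zcomp s f.
Proof.
move=> [_ max1] hf f0; apply: NNPP => nf.
pose Q n : bring k -> Prop := fun g => match n with
  | 0 => zideal X g | 1 => eval_at g P = 0 | _ => True end.
have idQ n : forms_ideal (Q n).
  case: n => [|[|n]].
  - have idX := zideal_is_ideal X.
    by split=> [u v|u v]; [exact: idealD | exact: ideal_mull].
  - split=> [u v|u v]; rewrite /Q ?eval_atD ?eval_atM; first by move=> -> ->; rewrite addr0.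
    by move=> ->; rewrite mulr0.
  - by split.
have JQ n g : zideal X g -> Q n g.
  case: n => [|[|n]] // Xg; rewrite /Q; have [N ->] := sum_bipart g.
  rewrite /eval_at raddf_sum big1 // => u _; rewrite raddf_sum big1 // => v _.
  by apply/(proj1 (zcomp_radical s g)); exists 1%N; apply: Xg.
have fracE (u v u' v' : bring k) : eval_at v P != 0 -> eval_at v' P != 0 ->
    FracField.tofrac u / FracField.tofrac v = FracField.tofrac u' / FracField.tofrac v' ->
    u * v' = u' * v.
  move=> v0 v'0 e; apply/eqP; rewrite -tofrac_eq; apply/eqP.
  rewrite !tofracM; apply: div_cross e.
    exact: (eval_at_neq0 v0).
  exact: (eval_at_neq0 v'0).
suff /max1 : local_chain (zideal X) P 2 by [].
exists (fun n => fractions_over P (Q n)); split=> [n _|n n2].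
  exact: fractions_submod (idQ n) (JQ n).
split.
  move=> z; apply: fractions_overS => g; case: n n2 => [|[|//]] _; last by [].
  exact: (JQ 1%N).
case: n n2 => [|[|//]] _.
  have [g hg g0] := form_nonzero_at P i j.
  exists (FracField.tofrac f / FracField.tofrac g); first by exists i, j, f, g.
  case=> [i' [j' [f' [g' [hf' hg' Xf' g'0 /(fracE _ _ _ _ g0 g'0) fg]]]]].
  apply: nf; apply: (zcomp_cancel hg' g'0); rewrite fg mulrC.
  apply: (ideal_mull (zcomp_is_ideal s)); apply: Xf'.
have e1 : eval_at (1 : bring k) P != 0 by rewrite /eval_at meval1 oner_neq0.
exists (FracField.tofrac 1 / FracField.tofrac 1).
  by exists 0%N, 0%N, 1, 1; split=> //; apply: bihom1.
case=> [i' [j' [f' [g' [hf' hg' f'0 g'0 /(fracE _ _ _ _ e1 g'0)]]]]].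
by rewrite mul1r mulr1 => gf; rewrite gf f'0 eqxx in g'0.
Qed.

End MultiplicityOne.

(** * Points in the plane and the removal of a point *)
Section Position.
Variable k : closedFieldType.

(** Vectors (1, z) suffice: z must avoid the roots of a product of finitely many
    nonzero polynomials, and k is infinite. *)
Lemma det2_avoid (T : finType) (v : T -> 'rV[k]_2) :
  (forall t, v t != 0) -> exists w : 'I_2 -> k, forall t, det2 (v t 0) w != 0.
Proof.
move=> v0; pose F t := (v t 0 ord0) *: 'X - (v t 0 ord_max)%:P.
have F0 : \prod_t F t != 0.
  apply/prodf_neq0 => t _; apply: contra (v0 t) => /eqP Ft.
  have c1 := congr1 (fun g : {poly k} => g`_1) Ft.
  have c0 := congr1 (fun g : {poly k} => g`_0) Ft.
  rewrite /= coefB coefZ coefX coefC /= coef0 mulr1 subr0 in c1.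
  rewrite /= coefB coefZ coefX coefC /= coef0 mulr0 sub0r in c0.
  move/eqP: c0; rewrite oppr_eq0 => /eqP c0.
  apply/eqP/rowP => -[[|[|//]] ti]; rewrite mxE; [rewrite -[RHS]c1 | rewrite -[RHS]c0];
  by congr (v t 0 _); apply: val_inj.
have /closed_nonrootP[z] := F0.
rewrite /root horner_prod => /prodf_neq0 hz.
exists (fun s => if s == ord0 then 1 else z) => t; have /= := hz t isT.
by rewrite /F hornerD hornerN hornerZ hornerX hornerC /det2 /= mulr1.
Qed.

Lemma det2_eq0 (u v : 'rV[k]_2) :
  u != 0 -> v != 0 -> det2 (u 0) (v 0) = 0 -> exists2 c, c != 0 & u = c *: v.
Proof.
move=> u0 v0 /eqP; rewrite subr_eq0 => /eqP d.
suff [c uc] : exists c, u = c *: v.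
  by exists c => //; apply: contraNneq u0 => c0; rewrite uc c0 scale0r.
have ext c : u 0 ord0 = c * v 0 ord0 -> u 0 ord_max = c * v 0 ord_max -> u = c *: v.
  move=> e0 e1; apply/rowP => -[[|[|//]] ti]; rewrite mxE.
    by rewrite (_ : Ordinal ti = ord0) //; apply: val_inj.
  by rewrite (_ : Ordinal ti = ord_max) //; apply: val_inj.
have [v00|v00] := eqVneq (v 0 ord0) 0; last first.
  exists (u 0 ord0 / v 0 ord0); apply: ext; first by rewrite divfK.
  by rewrite mulrAC d mulfK.
have v01 : v 0 ord_max != 0.
  apply: contra v0 => /eqP v01; apply/eqP/rowP => -[[|[|//]] ti]; rewrite mxE.
    by rewrite (_ : Ordinal ti = ord0) //; apply: val_inj.
  by rewrite (_ : Ordinal ti = ord_max) //; apply: val_inj.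
exists (u 0 ord_max / v 0 ord_max); apply: ext; last by rewrite divfK.
by rewrite mulrAC -d mulfK.
Qed.

Lemma bipart_neq i j i' j' (f : bring k) :
  bihom i j f -> (i', j') != (i, j) -> bipart i' j' f = 0.
Proof.
move=> hf ne; rewrite /bipart big_seq_cond big1 // => m /andP[/hf ->].
by rewrite eq_sym (negPf ne).
Qed.

Lemma bihom_point_ideal i j (f : bring k) P :
  bihom i j f -> eval_at f P = 0 -> point_ideal P f.
Proof.
move=> hf f0 i' j'; have [[-> ->]|ne] := eqVneq (i', j') (i, j).
  by rewrite bipart_id.
by rewrite (bipart_neq hf ne) /eval_at raddf0.
Qed.

Definition perp (v : 'rV[k]_2) (t : 'I_2) : k := if t == ord0 then v 0 ord_max else - v 0 ord0.

Lemma sum_perp v (u : 'rV[k]_2) : \sum_t perp v t * u 0 t = det2 (u 0) (v 0).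
Proof. by rewrite sum2 /perp /det2 /=; ring. Qed.

Lemma separating_form (P T : qpoint k) : ~ same_point T P ->
  exists i j f, [/\ bihom i j f, eval_at f T = 0 & eval_at f P != 0].
Proof.
move=> nsame.
have [dx|dx] := eqVneq (det2 (qx P 0) (qx T 0)) 0; last first.
  exists 1%N, 0%N, (lform (@lshift 2 2) (perp (qx T))).
  by rewrite !eval_xform !sum_perp dx; split; [exact: bihom_xform | rewrite /det2; ring |].
have [dy|dy] := eqVneq (det2 (qy P 0) (qy T 0)) 0; last first.
  exists 0%N, 1%N, (lform (@rshift 2 2) (perp (qy T))).
  by rewrite !eval_yform !sum_perp dy; split; [exact: bihom_yform | rewrite /det2; ring |].
have [c c0 hc] := det2_eq0 (qx_neq0 P) (qx_neq0 T) dx.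
have [d d0 hd] := det2_eq0 (qy_neq0 P) (qy_neq0 T) dy.
by case: nsame; exists c, d.
Qed.

(** A product over the points of Z of powers of forms separating them from P. *)
Lemma residual_separator (X : zscheme k) (s : zsupp X) :
  exists i j f, [/\ bihom i j f, zideal (zremove s) f & eval_at f (zpt s) != 0].
Proof.
pose sep (t : zsupp X) f := [/\ exists i j, bihom i j f, t != s -> zcomp t f &
  eval_at f (zpt s) != 0].
have ex t : exists f, sep t f.
  have [->|ts] := eqVneq t s.
    exists 1; split; rewrite ?eqxx //; first by exists 0%N, 0%N; apply: bihom1.
    by rewrite /eval_at meval1 oner_neq0.
  have [|i [j [f [hf ft fs]]]] := @separating_form (zpt s) (zpt t).
    by move=> /zpt_inj /eqP; rewrite (negPf ts).
  have [n fn] : radical (zcomp t) f by apply/zcomp_radical/(bihom_point_ideal hf).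
  exists (f ^+ n); split=> //; last by rewrite eval_atXn expf_neq0.
  by exists (n * i)%N, (n * j)%N; apply: bihomXn.
pose F t := epsilon (inhabits 0) (sep t).
have FP t : sep t (F t) := epsilon_spec (inhabits 0) _ (ex t).
have [i [j hF]] : exists i j, bihom i j (\prod_t F t).
  elim/big_ind: _ => [|f g [i [j hf]] [i' [j' hg]]|t _]; last by case: (FP t).
    by exists 0%N, 0%N; apply: bihom1.
  by exists (i + i')%N, (j + j')%N; apply: bihomM.
exists i, j, (\prod_t F t); split=> //.
  move=> t; rewrite (bigD1 (val t)) //=.
  apply: (ideal_mulr (zcomp_is_ideal (val t))); case: (FP (val t)).
  by move=> _ + _; apply; apply: (valP t).
by rewrite eval_at_prod; apply/prodf_neq0 => t _; case: (FP t).
Qed.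

Lemma zideal_remove (X : zscheme k) (s : zsupp X) f :
  zideal X f <-> zideal (zremove s) f /\ zcomp s f.
Proof.
split=> [Xf|[Zf sf] t]; first by split=> [t|]; apply: Xf.
by have [->//|ts] := eqVneq t s; apply: (Zf (exist _ t ts)).
Qed.

End Position.

(** * The Hilbert matrix after the removal of a point *)
Section AffineShape.
Variable k : closedFieldType.
Local Notation kyx := {poly {poly k}}.

Lemma bounded_col j (f : kyx) :
  bounded 0 j f -> exists2 E : {poly k}, f = E%:P & (size E <= j.+1)%N.
Proof.
case/andP => /size1_polyC -> ; rewrite swapXY_polyC size_map_polyC => h.
by exists f`_0.
Qed.

Lemma bounded_row i (f : kyx) :
  bounded i 0 f -> exists2 D : {poly k}, f = D^:P & (size D <= i.+1)%N.
Proof.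
rewrite -bounded_swapXY => /bounded_col[D fD sD]; exists D => //.
by rewrite -swapXY_polyC -fD swapXYK.
Qed.

Lemma linear_X (p : {poly k}) : (size p <= 2)%N -> p`_0 = 0 -> p = p`_1 *: 'X.
Proof.
move=> sp p0; apply/polyP => -[|[|i]]; rewrite coefZ coefX ?mulr0 ?mulr1 //.
by rewrite nth_default // (leq_trans sp).
Qed.

Lemma separatesW I i j i' j' : (i <= i')%N -> (j <= j')%N ->
  separates I i j -> separates I i' j' (k := k).
Proof. by move=> ii jj [f [If fb f0]]; exists f; split=> //; apply: boundedW fb. Qed.

(** To replace q + m + 1 by q + m in the first bidegree: all (q + m + 1, j) with
    j >= p separate, so that the step leads from (q + m, p + n) down to
    (q + m, p), one column at a time. *)
Lemma separates_descent (I : kyx -> Prop) q p m n :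
  (forall i j, (q <= i)%N -> (p <= j)%N ->
     separates I i.+1 j -> separates I i j.+1 -> separates I i j) ->
  separates I (q + m) p -> separates I q (p + n) -> separates I q p.
Proof.
move=> step; elim: m => [|m IH] hm hn; first by rewrite addn0 in hm.
apply: IH => //; have : separates I (q + m) (p + n) by apply: separatesW hn; lia.
elim: n {hn} => [|n IHn] hn; first by rewrite addn0 in hn.
apply: IHn; apply: step; try lia; last by rewrite addnS in hn.
by rewrite addnS in hm; apply: separatesW hm; lia.
Qed.

Lemma line_gen_swapped2 I (G : {poly k}) : line_gen I G -> line_gen (swapped (swapped I)) G.
Proof.
move=> [G0 GP]; split=> // g; rewrite -GP /swapped.
by split=> -[f If fg]; exists f; rewrite ?swapXYK // in If *.
Qed.

End AffineShape.

Section Origin.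
Variable k : closedFieldType.
Variables (P : qpoint k) (A1 B1 : 'I_2 -> k).
Local Notation dehom := (dehomogenize (qx P 0) A1 (qy P 0) B1).

(** P is the origin of the chart. *)
Lemma dehom_eval f : (dehom f)`_0`_0 = eval_at f P.
Proof.
rewrite -[LHS]horner_coef0 -[X in _.[X]]/(0 : k) -[_`_0]horner_coef0.
apply: (@mpoly_rmorph_eq _ _ (horner_eval 0 \o (horner_eval 0 \o dehom) : {rmorphism _ -> _})
  (meval (row_mx (qx P) (qy P) 0) : {rmorphism _ -> _})) => [c|i] /=.
  by rewrite dehomC /horner_eval !hornerC mevalC.
rewrite mevalXU -[i]splitK; case: (split i) => t /=.
  by rewrite dehomXl row_mxEl /horner_eval !hornerE.
by rewrite dehomXr row_mxEr /horner_eval !hornerE.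
Qed.

End Origin.

Section Denominators.
Variable k : closedFieldType.
Lemma eval_xdenom (A0 A1 : 'I_2 -> k) P :
  eval_at (xdenom A0 A1) P = det2 (qx P 0) A1 / det2 A0 A1.
Proof. by rewrite eval_xform sum2 /denom_coef /= /det2; ring. Qed.
Lemma eval_ydenom (A0 A1 : 'I_2 -> k) P :
  eval_at (ydenom A0 A1) P = det2 (qy P 0) A1 / det2 A0 A1.
Proof. by rewrite eval_yform sum2 /denom_coef /= /det2; ring. Qed.
End Denominators.

Theorem corollary1 (k : closedFieldType) (X : zscheme k) (a b : nat)
    (hsize : has_size X a b)
    (R : 'I_a.+1 -> bring k) (hR : row_lines X R)
    (C : 'I_b.+1 -> bring k) (hC : col_lines X C)
    (s : zsupp X) (h : 'I_a.+1) (c : 'I_b.+1)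
    (hP : meet_at (R h) (C c) (zpt s))
    (hmult : mult_is X (zpt s) 1%N)
    (Z : zscheme k) (hZ : Z = zremove s)
    (p q : nat) (hp : p = on_line Z (R h)) (hq : q = on_line Z (C c))
    (hcond : [\/ p = b,
                 q = a
               | [/\ (p < b)%N, (q < a)%N
                   & forall i j : int, (q.+1)%:Z <= i -> (p.+1)%:Z <= j ->
                       dhilbM X i j = 0]]) :
  forall i j : int,
    dhilbM Z i j =
      if (i, j) == (q%:Z, p%:Z) then dhilbM X i j - 1 else dhilbM X i j.
Proof.
set P := zpt s.
(* An affine chart with P as origin, whose lines at infinity miss X. *)
have [A1 hA1] := det2_avoid (fun t : zsupp X => qx_neq0 (zpt t)).
have [B1 hB1] := det2_avoid (fun t : zsupp X => qy_neq0 (zpt t)).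
pose dh := dehomogenize (qx P 0) A1 (qy P 0) B1.
have hA : det2 (qx P 0) A1 != 0 by apply: hA1.
have hB : det2 (qy P 0) B1 != 0 by apply: hB1.
have hx : forall t : zsupp Z, eval_at (xdenom (qx P 0) A1) (zpt t) != 0.
  by rewrite hZ => t; rewrite eval_xdenom mulf_neq0 ?invr_neq0 //; apply: hA1.
have hy : forall t : zsupp Z, eval_at (ydenom (qy P 0) B1) (zpt t) != 0.
  by rewrite hZ => t; rewrite eval_ydenom mulf_neq0 ?invr_neq0 //; apply: hB1.
pose I := affine_ideal (qx P 0) A1 (qy P 0) B1 (zideal Z).
have idI : ideal I by apply: affine_ideal_is_ideal.
have IE i j f : bihom i j f -> I (dh f) <-> zideal Z f by apply: affine_idealE.
have XZ f : zideal X f <-> zideal Z f /\ zcomp s f by rewrite hZ; apply: zideal_remove.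
have [[hRt XR] [hCt XC]] := (hR, hC).
have [RP CP] : eval_at (R h) P = 0 /\ eval_at (C c) P = 0.
  apply/(hP P); exists 1, 1; rewrite !scale1r; split=> //; exact: oner_neq0.
have bR : bihom a.+1 0 (\prod_t R t).
  have := @bihom_prod k _ (index_enum _) xpredT R (fun=> 1%N) (fun=> 0%N).
  rewrite sum1_card card_ord big1 //; apply=> t _; by case: (hRt t).
have bC : bihom 0 b.+1 (\prod_t C t).
  have := @bihom_prod k _ (index_enum _) xpredT C (fun=> 0%N) (fun=> 1%N).
  rewrite sum1_card card_ord big1 //; apply=> t _; by case: (hCt t).
have dh_inj0 i j f : bihom i j f -> f != 0 -> dh f != 0.
  move=> hf; apply: contra => /eqP f0; apply/eqP.
  by apply: (dehom_inj hA hB hf (@bihom0 _ i j)); rewrite [LHS]f0 [RHS]rmorph0.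
have [D DE sD] := bounded_row (bounded_dehom (qx P 0) A1 (qy P 0) B1 bR).
have [E EE sE] := bounded_col (bounded_dehom (qx P 0) A1 (qy P 0) B1 bC).
have ID : I D^:P by rewrite -DE; apply/(IE _ _ _ bR); case/XZ: XR.
have IEp : I E%:P by rewrite -EE; apply/(IE _ _ _ bC); case/XZ: XC.
have D0 : D != 0.
  have : dh (\prod_t R t) != 0.
    by apply: (dh_inj0 _ _ _ bR); apply/prodf_neq0 => t _; case: (hRt t).
  by rewrite /dh DE; apply: contra => /eqP ->; rewrite map_poly0.
have E0 : E != 0.
  have : dh (\prod_t C t) != 0.
    by apply: (dh_inj0 _ _ _ bC); apply/prodf_neq0 => t _; case: (hCt t).
  by rewrite /dh EE; apply: contra => /eqP ->; rewrite polyC0.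
have D00 : D`_0 = 0.
  have := dehom_eval P A1 B1 (\prod_t R t); rewrite DE coef_map coefC /= => ->.
  by rewrite eval_at_prod (bigD1 h) //= RP mul0r.
have E00 : E`_0 = 0.
  have := dehom_eval P A1 B1 (\prod_t C t); rewrite EE coefC /= => ->.
  by rewrite eval_at_prod (bigD1 c) //= CP mul0r.
have [i0 [j0 [F0 [hF0 ZF0 F0P]]]] := residual_separator s.
rewrite -hZ -/P in ZF0 F0P.
have sepF0 : separates I i0 j0.
  exists (dh F0); split; [exact/(IE _ _ _ hF0) | exact: bounded_dehom |].
  by rewrite dehom_eval.
have [f0 [If0 _ f00]] := sepF0.
have [G gG] : exists G, line_gen I G.
  apply: (line_gen_exists idI If0); apply: contraNneq f00 => ->.
  by rewrite coef0.
have sepF0' : separates (swapped I) j0 i0 by apply/separates_swapped.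
have [f1 [If1 _ f10]] := sepF0'.
have [H gH] : exists H, line_gen (swapped I) H.
  apply: (line_gen_exists (swapped_ideal idI) If1); apply: contraNneq f10 => ->.
  by rewrite coef0.
have G00 := line_gen_coef0 gG sepF0; have H00 := line_gen_coef0 gH sepF0'.
have sG : size G = p.+1.
  have [bRh Rh0 _] := hRt h.
  have [L LE sL] := bounded_row (bounded_dehom (qx P 0) A1 (qy P 0) B1 bRh).
  have L0 : L`_0 = 0.
    by have := dehom_eval P A1 B1 (R h); rewrite LE coef_map coefC /= RP.
  rewrite (linear_X sL L0) map_polyZ /= map_polyX -mul_polyC in LE.
  have L1 : L`_1 != 0.
    by have := dh_inj0 _ _ _ bRh Rh0; rewrite /dh LE;
      apply: contra => /eqP->; rewrite !polyC0 mul0r.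
  rewrite hp (on_line_row hA hB hx hy D0 ID E0 IEp bRh LE L1 gG).
  by rewrite prednK // lt0n size_poly_eq0; case: gG.
have sH : size H = q.+1.
  have [bCc Cc0 _] := hCt c.
  have [L LE sL] := bounded_col (bounded_dehom (qx P 0) A1 (qy P 0) B1 bCc).
  have L0 : L`_0 = 0.
    by have := dehom_eval P A1 B1 (C c); rewrite LE coefC /= CP.
  rewrite (linear_X sL L0) -mul_polyC polyCM in LE.
  have L1 : L`_1 != 0.
    by have := dh_inj0 _ _ _ bCc Cc0; rewrite /dh LE;
      apply: contra => /eqP->; rewrite !polyC0 mul0r.
  rewrite hq (on_line_col hA hB hx hy D0 ID E0 IEp bCc LE L1 gH).
  by rewrite prednK // lt0n size_poly_eq0; case: gH.
have hilbZ i j : hilb (zideal Z) i j = affine_hilb I i j.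
  apply: (hilbE hA hB (ideal_ksubspace idI)) => f hf.
  by apply: iff_sym; apply: IE hf.
have hilbX i j : hilb (zideal X) i j = affine_hilb (origin_part I) i j.
  apply: (hilbE hA hB (origin_part_ksubspace idI)) => f hf.
  rewrite XZ /origin_part dehom_eval (IE _ _ _ hf).
  split=> -[Zf sf]; split=> //; first exact: zcomp_eval0 hf sf.
  exact: mult1_zcomp hmult hf sf.
have sepXZ i j := affine_hilb_origin_part i j idI.
have sep_ge i j : separates I i j -> (q <= i)%N /\ (p <= j)%N.
  move=> sij; split.
    rewrite -ltnS -sH; apply: (separates_geq gH (i := j)).
    by apply/separates_swapped.
  by rewrite -ltnS -sG; apply: (separates_geq gG sij).
have sepqp : separates I q p.
  have -> : q = (size H).-1 by rewrite sH.
  have -> : p = (size G).-1 by rewrite sG.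
  case: hcond => [pb|qa|[_ _ dX0]].
  - by apply: (separates_corner idI gG gH G00 H00 E0 IEp E00); rewrite sG pb.
  - apply/separates_swapped.
    apply: (separates_corner (swapped_ideal idI) gH (line_gen_swapped2 gG) H00 G00 D0 _ D00).
      by rewrite /swapped swapXY_polyC.
    by rewrite sH qa.
  - have [M sepM] := separates_line idI gG G00 D0 ID.
    have IE' : swapped I E^:P by rewrite /swapped swapXY_map_polyC.
    have [N sepN] := separates_line (swapped_ideal idI) gH H00 E0 IE'.
    have {}sepN := (separates_swapped _ _ _).1 sepN.
    rewrite sG sH /= in sepM sepN *.
    have [qM _] := sep_ge _ _ sepM; have [_ pN] := sep_ge _ _ sepN.
    apply: (separates_descent (m := M - q) (n := N - p)); rewrite ?subnKC //.
    move=> i j qi pj s10 s01; apply: NNPP => s00.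
    (* The difference for Z would be 0 + 1 in a bidegree where Z has a
       separator, against [affine_hilb_corner]. *)
    have s11 : separates I i.+1 j.+1 by apply: separatesW s10.
    have := affine_hilb_corner idI s11.
    have := dX0 i.+1 j.+1; rewrite /dhilbM !subzSS !subr0 /= !hilbX.
    rewrite (sepXZ i.+1 j.+1).1 // (sepXZ i.+1 j).1 // (sepXZ i j.+1).1 //.
    rewrite (sepXZ i j).2 //; lia.
have sepE i j : reflect (separates I i j) ((q <= i) && (p <= j))%N.
  by apply: (iffP andP) => [[qi pj]|]; [exact: separatesW sepqp | exact: sep_ge].
pose u (i j : int) : int := ((q%:Z <= i) && (p%:Z <= j) : nat)%:Z.
have hMX i j : hilbM X i j = hilbM Z i j + u i j.
  rewrite /u; case: i j => [i|i] [j|j] //=; rewrite ?andbF //.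
  rewrite hilbX hilbZ !lez_nat; case: sepE => sij; first by rewrite (sepXZ i j).1 //; lia.
  by rewrite (sepXZ i j).2 // addr0.
move=> i j; rewrite /dhilbM !hMX /u xpair_eqE.
have le_pred (m n : int) : (m <= n - 1) = (m < n) by apply/idP/idP; lia.
rewrite !le_pred; case: (ltrgtP q%:Z i) => _; case: (ltrgtP p%:Z j) => _ /=; ring.
Qed.
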